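(* Let $n\ge 3$, let $\Omega\subset \mathbb{R}^{n}$ be a bounded convex domain, and let $g_\Omega$ be the complete conformal metric in $\Omega$ with constant scalar curvature $-n(n-1)$. Then $g_\Omega$ has negative sectional curvatures in $\Omega$ (every sectional curvature at every point of $\Omega$ is $<0$). Moreover, $g_\Omega$ has Ricci curvatures strictly less than $-\frac{n}{2}$ in $\Omega$, i.e. $\mathrm{Ric}_{g_\Omega}(X,X)<-\frac n2$ for every point of $\Omega$ and every tangent vector $X$ at that point with $g_\Omega(X,X)=1$.
   Context: A domain is a connected open set; $g_E$ is the Euclidean metric on $\mathbb{R}^n$. The complete conformal metric in $\Omega$ with constant scalar curvature $-n(n-1)$ is $g_\Omega=u^{\frac{4}{n-2}}g_E$, where $u$ is the unique positive solution of $\Delta u=\frac14 n(n-2)u^{\frac{n+2}{n-2}}$ in $\Omega$ with $u=\infty$ on $\partial\Omega$ (meaning $u(x)\to\infty$ as $x\to\partial\Omega$). *)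

(* Defs.v *)
From mathcomp Require Import all_boot all_order all_algebra.
From mathcomp Require Import all_classical all_reals all_analysis.

Set Implicit Arguments.
Unset Strict Implicit.
Unset Printing Implicit Defensive.

Import Order.TTheory GRing.Theory Num.Theory.
Import numFieldNormedType.Exports.
Local Open Scope classical_set_scope.
Local Open Scope ring_scope.

Section Calculus.
Context {R : realType} {n : nat}.
Implicit Types (f : 'rV[R]_n -> R) (D : set 'rV[R]_n).

Definition partial (i : 'I_n) f : 'rV[R]_n -> R :=
  fun x => 'D_(delta_mx 0 i) f x.

Definition laplacian f : 'rV[R]_n -> R :=
  fun x => \sum_(i < n) partial i (partial i f) x.

(* Only meant for open [D]: every derivative is taken and every continuity
   required at the points of [D], with no condition on [f] outside [D]. *)
Definition C2_on D f : Prop :=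
  forall x, D x ->
    [/\ {for x, continuous f},
        forall i, derivable f x (delta_mx 0 i),
        forall i, {for x, continuous (partial i f)},
        forall i j, derivable (partial i f) x (delta_mx 0 j) &
        forall i j, {for x, continuous (partial j (partial i f))}].

Definition domain D : Prop := open D /\ connected D.

(* For open [D], [closure D `\` D] is the topological boundary. *)
Definition blows_up_at_boundary D f : Prop :=
  forall p, (closure D `\` D) p -> f y @[y --> within D (nbhs p)] --> +oo.

End Calculus.

(* A metric is given by its Gram matrix [g x] in the standard coordinates of
   R^n, and a tangent vector at [x] by its row of components. *)
Section Curvature.
Context {R : realType} {n : nat}.
Variable g : 'rV[R]_n -> 'M[R]_n.

Definition gdot (x X Y : 'rV[R]_n) : R := (X *m g x *m Y^T) 0 0.

(* Gamma^k_ij, Levi-Civita connection *)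
Definition christoffel (k i j : 'I_n) (x : 'rV[R]_n) : R :=
  2%:R^-1 * \sum_(l < n) invmx (g x) k l *
    (partial i (fun y => g y j l) x + partial j (fun y => g y i l) x
     - partial l (fun y => g y i j) x).

(* The component along d_l of
   R(d_i, d_j) d_k = nabla_i nabla_j d_k - nabla_j nabla_i d_k. *)
Definition riemann (l i j k : 'I_n) (x : 'rV[R]_n) : R :=
  partial i (christoffel l j k) x - partial j (christoffel l i k) x
  + \sum_(m < n) (christoffel m j k x * christoffel l i m x
                  - christoffel m i k x * christoffel l j m x).

(* R(X, Y) Z *)
Definition curv (x X Y Z : 'rV[R]_n) : 'rV[R]_n :=
  \row_(l < n) \sum_(i < n) \sum_(j < n) \sum_(k < n)
    riemann l i j k x * X 0 i * Y 0 j * Z 0 k.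

(* Sectional curvature of the plane spanned by [X] and [Y], to be used for
   linearly independent [X] and [Y] only. *)
Definition sectional (x X Y : 'rV[R]_n) : R :=
  gdot x (curv x X Y Y) X
  / (gdot x X X * gdot x Y Y - gdot x X Y ^+ 2).

(* Ric(Y, Z) is the trace of X |-> R(X, Y) Z. *)
Definition ricci (x Y Z : 'rV[R]_n) : R :=
  \sum_(i < n) curv x (delta_mx 0 i) Y Z 0 i.

End Curvature.

Section LoewnerNirenberg.
Context {R : realType} {n : nat}.
Implicit Types (D : set 'rV[R]_n) (u : 'rV[R]_n -> R).

(* [u] is the positive classical solution in [D] of the Loewner-Nirenberg
   problem; its values outside [D] are irrelevant. *)
Definition loewner_nirenberg D u : Prop :=
  [/\ C2_on D u,
      forall x, D x -> 0 < u x,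
      forall x, D x ->
        laplacian u x =
          4%:R^-1 * n%:R * (n%:R - 2%:R)
          * u x `^ ((n%:R + 2%:R) / (n%:R - 2%:R)) &
      blows_up_at_boundary D u].

(* u^(4/(n-2)) g_E, where the Euclidean metric g_E has Gram matrix 1 *)
Definition conformal_metric u : 'rV[R]_n -> 'M[R]_n :=
  fun x => (u x `^ (4%:R / (n%:R - 2%:R))) *: 1%:M.

End LoewnerNirenberg.

(* Main.v *)
Require Import Defs.
From mathcomp Require Import all_boot all_order all_algebra.
From mathcomp Require Import all_classical all_reals all_analysis.
From mathcomp Require Import ring lra.
Import Order.TTheory GRing.Theory Num.Theory.
Import numFieldNormedType.Exports.
Local Open Scope classical_set_scope.
Local Open Scope ring_scope.
Set Implicit Arguments.
Unset Strict Implicit.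
Unset Printing Implicit Defensive.

(** Write the solution as u = v^(-(n-2)/2), so that the metric is v^(-2) times
the Euclidean one, and put z = ln v and c = n/2. The equation for u becomes
  Lap z = (c - 1) |grad z|^2 - c e^(-2z),  that is,
  v Lap v = c (|grad v|^2 - 1),
and blow-up of u says that v, extended by zero, is continuous on R^n.

The metric is conformally flat, so its curvature tensor is built from the
symmetric form B = - Hess z - dz (x) dz + |dz|^2/2 I ([riemann_conformal]).
Sectional curvatures are negative as soon as B is positive definite, and on
g-unit vectors Ric(X, X) = - n/2 - (n - 2) B(X, X), because the equation fixes
the trace of B. Now - B = Hess v / v - |dz|^2/2 I, so it is enough to know that
v is concave, and that Hess z is negative definite where grad z vanishes.

Concavity ([exp_on_concave]) is a two-point maximum principle. For k > 1 one
minimises k v(x2) - l v(x1) - (1-l) v(x3), with x2 = l x1 + (1-l) x3, over the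
closure. A negative minimum cannot involve a boundary point: comparison of v
with its image under a homothety into the domain gives v(x2) >= (1-l) v(x3)
([star_shaped]). At an interior minimum the gradients at x1 and x3 agree, the
one at x2 is the same up to the factor k, and moving x1 and x3 with independent
speeds s and t gives an inequality between the three Laplacians which the
equation refutes for a good choice of s and t ([conv_min_absurd]). Then k
tends to 1. The factor k > 1 removes the degenerate case |grad v| = 1.

Strictness ([log_strictly_concave]) is a strong maximum principle for the second
difference D(x) = 2 z(x) - z(x + h e) - z(x - h e). Concavity of v makes D
nonnegative and makes it dominate the squares of the two increments of z; this
is exactly what controls the bad sign of the zeroth order term, so that
Lap D <= 2(c-1) grad z . grad D + C D with constants independent of h
([touching_inequality]). An exponential barrier then carries a lower bound
D >= m h^2, uniform in small h, from one ball to larger ones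
([unif_lower_spread]) and along segments. Such a bound holds near some point of
every line of direction e, since z tends to minus infinity where the line leaves
the bounded domain ([line_nonconstant]). Letting h tend to 0 gives
Hess z(e, e) < 0 everywhere. Working with differences of z instead of
differentiating the equation keeps the argument within C^2. *)

(** * Second-order jets of functions of one variable *)

Section Jets.
Context {R : realType}.
Implicit Types (f g : R -> R).

Lemma is_derive_comp1 f g (x df dg : R) :
  is_derive x 1 f df -> is_derive (f x) 1 g dg ->
  is_derive x 1 (fun t => g (f t)) (dg * df).
Proof.
move=> [fx <-] [gx <-]; split.
  apply/derivable1_diffP; apply: differentiable_comp; exact/derivable1_diffP.
by rewrite -!derive1E (derive1_comp fx gx).
Qed.

Lemma is_derive_mull (k x : R) : is_derive x 1 (fun r : R => k * r) k.
Proof.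
have := @is_deriveZ _ _ _ (@id R) k x 1 1 (is_derive_id x 1).
by rewrite [X in is_derive _ _ _ X]mulr1.
Qed.

(** First and second derivative at 0, as a relation: the jet of a sum or of a
composite is then found by applying lemmas, and derivability comes along. All
second derivative tests below are made along lines, so one variable suffices. *)
Definition jet2 f (a b : R) : Prop :=
  exists f' : R -> R, [/\ \forall t \near (0 : R), is_derive (t : R) 1 f (f' t),
    f' 0 = a & is_derive (0 : R) 1 f' b].

Lemma jet2_near f g a b :
  (\forall t \near (0 : R), f t = g t) -> jet2 f a b -> jet2 g a b.
Proof.
move=> fg [f' [df fa fb]]; exists f'; split => //.
have /near_join fg2 := fg.
near=> t.
have fgt : \forall s \near t, f s = g s by near: t.
apply: near_eq_is_derive fgt _.
by near: t.
Unshelve. all: by end_near. Qed.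

Lemma jet2_cst (c : R) : jet2 (fun _ => c) 0 0.
Proof.
exists (fun _ => 0); split => //; last exact: is_derive_cst.
by near=> t; exact: is_derive_cst.
Unshelve. all: by end_near. Qed.

Lemma jet2D f g a b c d : jet2 f a b -> jet2 g c d ->
  jet2 (fun t => f t + g t) (a + c) (b + d).
Proof.
move=> [f' [df <- fb]] [g' [dg <- gb]]; exists (fun t => f' t + g' t); split => //.
- near=> t; apply: is_deriveD; by near: t.
- exact: is_deriveD.
Unshelve. all: by end_near. Qed.

Lemma jet2Z k f a b : jet2 f a b -> jet2 (fun t => k * f t) (k * a) (k * b).
Proof.
move=> [f' [df <- fb]]; exists (fun t => k * f' t); split => //.
- near=> t; apply: is_deriveZ; by near: t.
- exact: is_deriveZ.
Unshelve. all: by end_near. Qed.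

Lemma jet2_eq f a b c d : jet2 f a b -> a = c -> b = d -> jet2 f c d.
Proof. by move=> + <- <-. Qed.

Lemma jet2N f a b : jet2 f a b -> jet2 (fun t => - f t) (- a) (- b).
Proof.
move=> /(jet2Z (-1)) h; apply: jet2_eq.
- apply: jet2_near h; near=> t; by rewrite mulN1r.
- by rewrite mulN1r.
- by rewrite mulN1r.
Unshelve. all: by end_near. Qed.

Lemma jet2B f g a b c d : jet2 f a b -> jet2 g c d ->
  jet2 (fun t => f t - g t) (a - c) (b - d).
Proof. by move=> hf /jet2N; exact: jet2D. Qed.

Lemma jet2_scale k f a b : jet2 f a b ->
  jet2 (fun t => f (k * t)) (k * a) (k ^+ 2 * b).
Proof.
move=> [f' [df <- fb]]; exists (fun t => k * f' (k * t)).
have dk := is_derive_mull k.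
split.
- have : \forall t \near (0 : R), is_derive (k * t : R) 1 f (f' (k * t)).
    have : (fun t : R => k * t) @ (0 : R) --> (0 : R).
      rewrite -[X in _ --> X](mulr0 k); apply: cvgM; first exact: cvg_cst.
      exact: cvg_id.
    by move=> h; exact: (h _ df).
  move=> h; near=> t.
  rewrite mulrC; apply: is_derive_comp1 => //.
  by near: t.
- by rewrite mulr0.
- rewrite expr2 -mulrA.
  apply: is_deriveZ.
  rewrite mulrC.
  apply: is_derive_comp1 => //.
  by rewrite mulr0.
Unshelve. all: by end_near. Qed.

Lemma jet2_comp g g1 (g2 : R) f a b :
  (\forall y \near f 0, is_derive (y : R) 1 g (g1 y)) ->
  is_derive (f 0 : R) 1 g1 g2 -> jet2 f a b ->
  jet2 (fun t => g (f t)) (g1 (f 0) * a) (g2 * a ^+ 2 + g1 (f 0) * b).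
Proof.
move=> dg dg1 [f' [df <- fb]].
exists (fun t => g1 (f t) * f' t).
have df0 : is_derive (0 : R) 1 f (f' 0) by exact: nbhs_singleton df.
have cf : f t @[t --> (0:R)] --> f 0.
  by apply/differentiable_continuous/derivable1_diffP; case: df0.
split => //.
- have h : \forall t \near (0 : R), is_derive (f t : R) 1 g (g1 (f t)).
    exact: (cf _ dg).
  near=> t; apply: is_derive_comp1; by near: t.
- apply: (@is_derive_eq _ _ _ ((fun t => g1 (f t)) * f')).
  by rewrite /= /GRing.scale /=; ring.
Unshelve. all: by end_near. Qed.

Lemma jet2_expR f a b : jet2 f a b ->
  jet2 (fun t => expR (f t)) (expR (f 0) * a) (expR (f 0) * (b + a ^+ 2)).
Proof.
move=> h; apply: (jet2_eq (jet2_comp (g := expR) (g1 := expR) _ _ h)) => //.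
- by near=> y; exact: is_derive_expR.
- by ring.
Unshelve. all: by end_near. Qed.

(** If the second derivative were negative, the first one would be negative just
to the right of 0, and the function would decrease there. *)
Lemma jet2_min f a b : (\forall t \near (0 : R), f 0 <= f t) -> jet2 f a b ->
  a = 0 /\ 0 <= b.
Proof.
move=> fm [f' [df fa fb]].
have [e /= e0 he] : exists2 e : R, 0 < e & forall t : R, `|t| < e ->
    f 0 <= f t /\ is_derive (t : R) 1 f (f' t).
  have : \forall t \near (0:R), f 0 <= f t /\ is_derive (t : R) 1 f (f' t).
    by near=> t; split; near: t.
  move=> /nbhs_ballP[e /= e0 he]; exists e => // t te; apply: he.
  by rewrite /ball /= sub0r normrN.
have a0 : a = 0.
  have : is_derive (0 : R) 1 f 0.
    apply: (@derive1_at_min _ f (- e) e) => //.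
    - lra.
    - move=> t; rewrite in_itv /= => te; case: (he t) => //.
      by rewrite ltr_norml.
    - rewrite in_itv /=; lra.
    - move=> t; rewrite in_itv /= => te; case: (he t) => //.
      by rewrite ltr_norml.
  have [//|_ h0] := he 0; first by rewrite normr0.
  move=> h1; rewrite -fa.
  by rewrite -(@derive_val _ _ _ _ _ _ _ h0) (@derive_val _ _ _ _ _ _ _ h1).
split => //.
rewrite leNgt; apply/negP => b0.
(* the sign of [f'] near 0 is that of [b] times [t], as [f' 0 = 0] *)
have : \forall t \near (0:R)^', t^-1 * f' t < 0.
  have [cf vf] := fb.
  have : (fun h : R => h^-1 *: ((f' \o shift 0) (h *: 1) - f' 0)) @ 0^' --> b.
    by rewrite -vf; exact: cf.
  move=> /cvgr_lt /(_ _ b0); apply: filterS => t /=.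
  by rewrite addr0 fa a0 subr0 [t *: 1]mulr1.
rewrite near_withinE => /nbhs_ballP[d /= d0 hd].
pose s := Num.min e d / 2.
have sm : 0 < s /\ (s < e /\ s < d).
  have m0 : 0 < Num.min e d by rewrite lt_min e0 d0.
  have : Num.min e d <= e /\ Num.min e d <= d by rewrite !ge_min !lexx orbT.
  by rewrite /s; move=> [? ?]; split; [lra|split; lra].
case: sm => s0 [se sd].
have [//| | |x x01 E] := @MVT R f f' 0 s.
- move=> x; rewrite in_itv /= => /andP[x0 xs].
  by case: (he x) => //; rewrite gtr0_norm// (lt_trans xs).
- apply: derivable_within_continuous => x; rewrite in_itv /= => /andP[x0 xs].
  case: (he x) => [|_ []//].
  by rewrite ger0_norm// (le_lt_trans xs).
move: x01; rewrite in_itv /= => /andP[x0 xs].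
have fx : f' x < 0.
  have xne : x != 0 by rewrite gt_eqF.
  have := hd x; rewrite /ball /= sub0r normrN gtr0_norm//.
  move=> /(_ (lt_trans xs sd) xne).
  by rewrite pmulr_rlt0 // invr_gt0.
have [|fs _] := he s; first by rewrite gtr0_norm.
have : f' x * (s - 0) < 0 by rewrite subr0 pmulr_llt0.
by rewrite -E; lra.
Unshelve. all: by end_near. Qed.

End Jets.

(** * Functions of several variables restricted to lines *)

Section Lines.
Context {R : realType} {V : normedModType R}.
Implicit Types (f : V -> R) (x e a b : V) (D : set V).

(** Both signs of the increment at once, as needed for two-sided difference
quotients. *)
Lemma MVT_symmetric (g g' : R -> R) (h : R) :
  (forall s : R, `|s| <= `|h| -> is_derive s 1 g (g' s)) ->
  exists2 s : R, `|s| <= `|h| & g h - g 0 = g' s * h.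
Proof.
move=> dg; have [h0|h0] := lerP 0 h.
  have [//| | |s s0 E] := @MVT_segment R g g' 0 h.
  - move=> s; rewrite in_itv /= => /andP[? ?]; apply: dg.
    by rewrite !ger0_norm // ltW.
  - apply: derivable_within_continuous => s; rewrite in_itv /= => /andP[? ?].
    by case: (dg s) => //; rewrite !ger0_norm.
  exists s; last by rewrite E subr0.
  by move: s0; rewrite in_itv /= => /andP[? ?]; rewrite !ger0_norm.
have [|| |s s0 E] := @MVT_segment R g g' h 0; first exact: ltW.
- move=> s; rewrite in_itv /= => /andP[? ?]; apply: dg.
  by rewrite !ltr0_norm // lerN2 ltW.
- apply: derivable_within_continuous => s; rewrite in_itv /= => /andP[? ?].
  by case: (dg s) => //; rewrite !ler0_norm ?lerN2 // ltW.
exists s; last by move: E; rewrite sub0r mulrN => E; lra.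
by move: s0; rewrite in_itv /= => /andP[? ?]; rewrite !ler0_norm ?lerN2 // ltW.
Qed.

Lemma cvg_line (x e : V) : (fun t : R => t *: e + x) t @[t --> (0 : R)] --> x.
Proof.
rewrite -[X in _ --> X]add0r -[X in _ --> X + _](scale0r e).
apply: cvgD; last exact: cvg_cst.
by apply: cvgZ; [exact: cvg_id|exact: cvg_cst].
Qed.

Lemma near_line (P : V -> Prop) x e :
  (\forall y \near x, P y) -> \forall t \near (0 : R), P (t *: e + x).
Proof. by move=> h; exact: (@cvg_line x e _ h). Qed.

Lemma is_derive_line f x e (t d : R) :
  is_derive (t *: e + x) e f d ->
  is_derive t 1 (fun s : R => f (s *: e + x)) d.
Proof.
move=> [cf vf].
have E : (fun h : R => h^-1 *: ((f \o shift (t *: e + x)) (h *: e) - f (t *: e + x)))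
   = (fun h : R => h^-1 *: (((fun s : R => f (s *: e + x)) \o shift t) (h *: 1) - f (t *: e + x))).
  apply/funext => h /=; rewrite [h *: 1]mulr1 scalerDl addrA //.
by split; rewrite /derivable /derive -E.
Qed.

Lemma line_is_derive f x e (d : R) :
  is_derive (0 : R) 1 (fun s : R => f (s *: e + x)) d -> is_derive x e f d.
Proof.
move=> [cf vf].
have E : (fun h : R => h^-1 *: ((f \o shift x) (h *: e) - f x))
   = (fun h : R => h^-1 *: (((fun s : R => f (s *: e + x)) \o shift 0) (h *: 1) - f (0 *: e + x))).
  by apply/funext => h /=; rewrite [h *: 1]mulr1 addr0 scale0r add0r.
by split; rewrite /derivable /derive E.
Qed.

Lemma near_norm_ball (P : V -> Prop) x : (\forall y \near x, P y) ->
  exists2 d : R, 0 < d & forall v, `|v| < d -> P (v + x).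
Proof.
move=> /nbhs_ballP[d /= d0 h]; exists d => // v vd; apply: h.
by rewrite -ball_normE /ball_ /= opprD addrCA subrr addr0 normrN.
Qed.

(** The increment along [h (a + b)] is the one along [h a] followed by one along
[h b] from a displaced base point; the mean value theorem and the continuity of
the derivative along [b] make the displacement harmless. *)
Lemma is_derive_add_dir f x a b (A : R) :
  (\forall y \near x, derivable f y b) -> {for x, continuous (fun y => 'D_b f y)} ->
  is_derive x a f A -> is_derive x (a + b) f (A + 'D_b f x).
Proof.
move=> db cb da.
have [cfa vfa] := da.
have La : (fun h : R => h^-1 *: ((f \o shift x) (h *: a) - f x)) @ 0^' --> A.
  by rewrite -vfa; exact: cfa.
suff Lb : (fun h : R => h^-1 *: (f (h *: (a + b) + x) - f (h *: a + x))) @ 0^' --> 'D_b f x.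
  have L : (fun h : R => h^-1 *: ((f \o shift x) (h *: (a + b)) - f x)) @ 0^'
      --> A + 'D_b f x.
    have -> : (fun h : R => h^-1 *: ((f \o shift x) (h *: (a + b)) - f x)) =
      (fun h : R => h^-1 *: ((f \o shift x) (h *: a) - f x) +
                    h^-1 *: (f (h *: (a + b) + x) - f (h *: a + x))).
      by apply/funext => h /=; rewrite -scalerDr; congr (_ *: _); ring.
    exact: cvgD.
  by split; [apply/cvg_ex; eexists; exact: L|exact: cvg_lim L].
apply/cvgrPdist_lt => eps eps0.
have [d d0 hd] : exists2 d : R, 0 < d & forall v, `|v| < d ->
    derivable f (v + x) b /\ `|'D_b f x - 'D_b f (v + x)| < eps.
  apply: (@near_norm_ball (fun y => derivable f y b /\ `|'D_b f x - 'D_b f y| < eps)).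
  move/cvgrPdist_lt : cb => /(_ _ eps0) cb.
  by near=> y; split; near: y.
pose K := `|a| + `|b| + 1.
have K0 : 0 < K by rewrite /K -addrA; apply: ltr_wpDl => //; apply: ltr_wpDl.
rewrite near_withinE.
apply/nbhs_ballP; exists (d / K) => /=; first exact: divr_gt0.
move=> h; rewrite /ball /= sub0r normrN => hK h0.
have small s : `|s| <= `|h| -> `|s *: b + h *: a| < d.
  move=> sh; apply: (le_lt_trans (ler_normD _ _)); rewrite !normrZ.
  have : `|s| * `|b| <= `|h| * `|b| by apply: ler_wpM2r.
  move: hK; rewrite ltr_pdivlMr // /K.
  have := normr_gt0 h; rewrite h0.
  nra.
have [|s sh E] := @MVT_symmetric (fun s : R => f (s *: b + (h *: a + x)))
   (fun s : R => 'D_b f (s *: b + (h *: a + x))) h.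
  move=> s sh; apply: is_derive_line; apply: derivableP.
  by rewrite addrA; case: (hd _ (small _ sh)).
rewrite scale0r add0r addrA -scalerDr [b + a]addrC in E.
rewrite E [_ *: _]mulrC mulfK // addrA.
by case: (hd _ (small _ sh)).
Unshelve. all: by end_near. Qed.

Lemma not_both_half_dist (p q r : R) :
  `|p - r| < `|p - q| / 2 -> `|r - q| < `|p - q| / 2 -> False.
Proof. by have := ler_distD r p q; lra. Qed.

(** Both mixed derivatives are limits of one second difference quotient, which is
symmetric in [a] and [b]. *)
Lemma Schwarz_symmetry f x a b :
  (\forall y \near x, [/\ derivable f y a, derivable f y b,
     derivable (fun z => 'D_a f z) y b & derivable (fun z => 'D_b f z) y a]) ->
  {for x, continuous (fun y => 'D_b (fun z => 'D_a f z) y)} ->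
  {for x, continuous (fun y => 'D_a (fun z => 'D_b f z) y)} ->
  'D_b (fun z => 'D_a f z) x = 'D_a (fun z => 'D_b f z) x.
Proof.
(* two successive mean values, first along [a'], then along [b'] *)
have key a' b' : (\forall y \near x, derivable f y a' /\ derivable (fun z => 'D_a' f z) y b') ->
    {for x, continuous (fun y => 'D_b' (fun z => 'D_a' f z) y)} ->
    forall eps : R, 0 < eps -> \forall t \near (0:R)^',
    `|'D_b' (fun z => 'D_a' f z) x -
      (f (t *: (a' + b') + x) - f (t *: a' + x) - f (t *: b' + x) + f x) / t ^+ 2| < eps.
  move=> df cf eps eps0.
  have [d d0 hd] : exists2 d : R, 0 < d & forall v, `|v| < d ->
      [/\ derivable f (v + x) a', derivable (fun z => 'D_a' f z) (v + x) b' &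
       `|'D_b' (fun z => 'D_a' f z) x - 'D_b' (fun z => 'D_a' f z) (v + x)| < eps].
    apply: (@near_norm_ball (fun y => [/\ derivable f y a', derivable (fun z => 'D_a' f z) y b' &
       `|'D_b' (fun z => 'D_a' f z) x - 'D_b' (fun z => 'D_a' f z) y| < eps])).
    move/cvgrPdist_lt : cf => /(_ _ eps0) cf.
    near=> y; have [? ?] : derivable f y a' /\ derivable (fun z => 'D_a' f z) y b' by near: y.
    by split => //; near: y.
  pose K := `|a'| + `|b'| + 1.
  have K0 : 0 < K by rewrite /K -addrA; apply: ltr_wpDl => //; apply: ltr_wpDl.
  rewrite near_withinE.
  apply/nbhs_ballP; exists (d / K) => /=; first exact: divr_gt0.
  move=> h; rewrite /ball /= sub0r normrN => hK h0.
  have small r s : `|r| <= `|h| -> `|s| <= `|h| -> `|r *: b' + s *: a'| < d.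
    move=> rh sh; apply: (le_lt_trans (ler_normD _ _)); rewrite !normrZ.
    have : `|r| * `|b'| <= `|h| * `|b'| by apply: ler_wpM2r.
    have : `|s| * `|a'| <= `|h| * `|a'| by apply: ler_wpM2r.
    move: hK; rewrite ltr_pdivlMr // /K.
    have := normr_gt0 h; rewrite h0.
    nra.
  have [|s sh E] := @MVT_symmetric
     (fun s : R => f (s *: a' + (h *: b' + x)) - f (s *: a' + x))
     (fun s : R => 'D_a' f (s *: a' + (h *: b' + x)) - 'D_a' f (s *: a' + x)) h.
    move=> s sh; apply: is_deriveB; apply: is_derive_line; apply: derivableP.
      rewrite addrA [s *: a' + _]addrC.
      by case: (hd _ (small h s (lexx _) sh)).
    have := small 0 s; rewrite normr0 scale0r add0r => /(_ (normr_ge0 _) sh) sa.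
    by case: (hd _ sa).
  have [|r rh E2] := @MVT_symmetric (fun r : R => 'D_a' f (r *: b' + (s *: a' + x)))
     (fun r : R => 'D_b' (fun z => 'D_a' f z) (r *: b' + (s *: a' + x))) h.
    move=> r rh; apply: (@is_derive_line (fun z => 'D_a' f z)); apply: derivableP.
    by rewrite addrA; case: (hd _ (small r s rh sh)).
  have -> : f (h *: (a' + b') + x) - f (h *: a' + x) - f (h *: b' + x) + f x
     = 'D_b' (fun z => 'D_a' f z) (r *: b' + (s *: a' + x)) * h * h.
    rewrite -E2 scale0r add0r [h *: b' + (s *: a' + x)]addrCA -E !scale0r !add0r.
    by rewrite scalerDr -!addrA; ring.
  rewrite -mulrA -expr2 mulfK; last by rewrite expf_neq0.
  by rewrite addrA; case: (hd _ (small r s rh sh)).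
move=> df cab cba.
have [//|lt_ne] := eqVneq ('D_b (fun z => 'D_a f z) x) ('D_a (fun z => 'D_b f z) x).
pose eps := `|'D_b (fun z => 'D_a f z) x - 'D_a (fun z => 'D_b f z) x| / 2.
have eps0 : 0 < eps by rewrite divr_gt0 // normr_gt0 subr_eq0.
have k1 := key a b _ cab _ eps0.
have k2 := key b a _ cba _ eps0.
have [t [h1 h2]] : exists t : R,
  `|'D_b (fun z => 'D_a f z) x -
      (f (t *: (a + b) + x) - f (t *: a + x) - f (t *: b + x) + f x) / t ^+ 2| < eps
  /\
  `|'D_a (fun z => 'D_b f z) x -
      (f (t *: (b + a) + x) - f (t *: b + x) - f (t *: a + x) + f x) / t ^+ 2| < eps.
  apply: (@filter_ex _ ((0:R)^')); apply: filterI.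
    by apply: k1; apply: filterS df => y [].
  by apply: k2; apply: filterS df => y [].
move: h2; rewrite [b + a]addrC [f _ - f (t *: b + x) - _]addrAC distrC => h2.
by case: (not_both_half_dist h1 h2).
Unshelve. all: by end_near. Qed.

End Lines.

Section DirDeriv.
Context {R : realType} {V : normedModType R}.
Implicit Types (f : V -> R) (x e : V).

Lemma is_derive_at_line f x e (d : R) :
  is_derive x e f d -> is_derive (0 : R) 1 (fun s : R => f (s *: e + x)) d.
Proof. by move=> h; apply: is_derive_line; rewrite scale0r add0r. Qed.

Lemma is_derive_comp_dir f (g : R -> R) x e (d dg : R) :
  is_derive x e f d -> is_derive (f x) 1 g dg ->
  is_derive x e (fun y => g (f y)) (dg * d).
Proof.
move=> hf hg; apply: line_is_derive.
apply: (@is_derive_comp1 _ (fun s : R => f (s *: e + x)) g).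
  exact: is_derive_at_line.
by rewrite scale0r add0r.
Qed.

Lemma is_derive_scale_dir f x e (c d : R) :
  is_derive x e f d -> is_derive x (c *: e) f (c * d).
Proof.
move=> hf; apply: line_is_derive; rewrite mulrC.
have -> : (fun s : R => f (s *: (c *: e) + x)) =
          (fun s : R => f ((c * s) *: e + x)).
  by apply/funext => s; rewrite scalerA mulrC.
apply: (@is_derive_comp1 _ (fun s : R => c * s) (fun s : R => f (s *: e + x))).
  exact: is_derive_mull.
by rewrite mulr0; exact: is_derive_at_line.
Qed.

End DirDeriv.

(** * Twice continuously differentiable functions on R^n *)

Section C2.
Context {R : realType} {n : nat}.
Implicit Types (D : set 'rV[R]_n) (f : 'rV[R]_n -> R) (x e : 'rV[R]_n).

Definition grad_dir f x e : R := \sum_(i < n) e 0 i * partial i f x.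

Definition hess_form f x e e' : R :=
  \sum_(i < n) \sum_(j < n) e 0 i * e' 0 j * partial j (partial i f) x.

Lemma grad_dirZ f x e (k : R) : grad_dir f x (k *: e) = k * grad_dir f x e.
Proof. by rewrite /grad_dir mulr_sumr; apply: eq_bigr => i _; rewrite mxE mulrA. Qed.

Lemma hess_formZ f x e (k : R) :
  hess_form f x (k *: e) (k *: e) = k ^+ 2 * hess_form f x e e.
Proof.
rewrite /hess_form mulr_sumr; apply: eq_bigr => i _; rewrite mulr_sumr.
by apply: eq_bigr => j _; rewrite !mxE; ring.
Qed.

Lemma grad_dir_delta f x i : grad_dir f x (delta_mx 0 i) = partial i f x.
Proof.
rewrite /grad_dir (bigD1 i) //= big1 ?addr0 => [|j ji].
  by rewrite mxE !eqxx mul1r.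
by rewrite mxE eqxx (negbTE ji) mul0r.
Qed.

Lemma hess_form_delta f x i :
  hess_form f x (delta_mx 0 i) (delta_mx 0 i) = partial i (partial i f) x.
Proof.
rewrite -grad_dir_delta -[X in grad_dir X]/(partial i f).
rewrite /hess_form (bigD1 i) //= [X in _ + X]big1 ?addr0 => [|j ji].
  by rewrite /grad_dir; apply: eq_bigr => j _; rewrite mxE !eqxx mul1r.
by rewrite big1 // => k _; rewrite mxE eqxx (negbTE ji) !mul0r.
Qed.

(** Continuous partial derivatives give all directional derivatives: the
coordinate directions are added one at a time. *)
Lemma is_derive_dir D f x e : open D ->
  (forall y, D y -> forall i, derivable f y (delta_mx 0 i)) ->
  (forall y, D y -> forall i, {for y, continuous (partial i f)}) ->
  D x -> is_derive x e f (grad_dir f x e).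
Proof.
move=> oD df cf Dx.
have nD : \forall y \near x, D y by exact: open_nbhs_nbhs.
have dfc y i c : D y -> is_derive y (c *: delta_mx 0 i) f (c * partial i f y).
  by move=> Dy; apply: is_derive_scale_dir; apply: derivableP; apply: df.
suff H (s : seq 'I_n) : is_derive x (\sum_(i <- s) e 0 i *: delta_mx 0 i) f
    (\sum_(i <- s) e 0 i * partial i f x).
  by rewrite [e in is_derive _ e]row_sum_delta; exact: H.
elim: s => [|i s IH]; first by rewrite !big_nil; exact: is_derive0.
rewrite !big_cons addrC [X in is_derive _ _ _ X]addrC.
have E : {near x, (fun y => 'D_(e 0 i *: delta_mx 0 i) f y) =1
                  (fun y => e 0 i * partial i f y)}.
  by apply: filterS nD => y Dy; have [] := dfc y i (e 0 i) Dy.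
have Ex := nbhs_singleton E; rewrite /= in Ex; rewrite -Ex.
apply: is_derive_add_dir => //.
  by apply: filterS nD => y Dy; have [] := dfc y i (e 0 i) Dy.
rewrite /prop_for /continuous_at Ex.
have E' : {near x, (fun y => e 0 i * partial i f y) =1
                   (fun y => 'D_(e 0 i *: delta_mx 0 i) f y)}.
  by apply: filterS E => y ->.
apply: cvg_trans (near_eq_cvg E') _.
by apply: cvgM; [exact: cvg_cst|exact: cf].
Qed.

Lemma C2_is_derive D f x e : open D -> C2_on D f -> D x ->
  is_derive x e f (grad_dir f x e).
Proof. by move=> oD h; apply: is_derive_dir oD _ _ => y /h[]. Qed.

Lemma jet2_C2 D f x e : open D -> C2_on D f -> D x ->
  jet2 (fun t => f (t *: e + x)) (grad_dir f x e) (hess_form f x e e).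
Proof.
move=> oD h Dx; exists (fun t => grad_dir f (t *: e + x) e); split.
- have nD : \forall y \near x, D y by exact: open_nbhs_nbhs.
  apply: filterS (@near_line _ _ _ _ e nD) => t Dt; apply: is_derive_line.
  exact: C2_is_derive oD h Dt.
- by rewrite scale0r add0r.
- apply: (@is_derive_at_line _ _ (fun y => grad_dir f y e)).
  have -> : (fun y => grad_dir f y e) = \sum_(i < n) e 0 i \*: partial i f.
    by apply/funext => y; rewrite fct_sumE.
  have -> : hess_form f x e e = \sum_(i < n) e 0 i *: grad_dir (partial i f) x e.
    apply: eq_bigr => i _; rewrite /grad_dir scaler_sumr.
    by apply: eq_bigr => j _; rewrite -mulrA.
  apply: is_derive_sum => i; apply: is_deriveZ.
  apply: (@is_derive_dir D) => // y Dy k; have [_ _ _ d2 c2] := h y Dy.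
    exact: d2.
  exact: c2.
Qed.

Lemma partial_sym D f x i j : open D -> C2_on D f -> D x ->
  partial j (partial i f) x = partial i (partial j f) x.
Proof.
move=> oD h Dx; apply: Schwarz_symmetry.
- have nD : \forall y \near x, D y by exact: open_nbhs_nbhs.
  by apply: filterS nD => y /h[_ d1 _ d2 _]; split => //; exact: d2.
- by have [_ _ _ _ c2] := h x Dx; exact: c2.
- by have [_ _ _ _ c2] := h x Dx; exact: c2.
Qed.

Lemma partial_near f g x i : (\forall y \near x, f y = g y) ->
  partial i f x = partial i g x.
Proof. exact: near_eq_derive. Qed.

Lemma partial_comp f (g : R -> R) x i (dg : R) :
  derivable f x (delta_mx 0 i) -> is_derive (f x) 1 g dg ->
  partial i (fun y => g (f y)) x = dg * partial i f x.
Proof.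
by move=> df hg; have [] := is_derive_comp_dir (derivableP df) hg.
Qed.

(** Closure of [C2_on] under composition with a function of one real variable,
with derivatives [g1] and [g2]; it is applied to the logarithm. *)
Section Composition.
Variables (D : set 'rV[R]_n) (f : 'rV[R]_n -> R) (g g1 g2 : R -> R).
Hypotheses (oD : open D) (hf : C2_on D f).
Hypothesis dg : forall x, D x -> is_derive (f x) 1 g (g1 (f x)).
Hypothesis dg1 : forall x, D x -> is_derive (f x) 1 g1 (g2 (f x)).
Hypothesis cg2 : forall x, D x -> {for f x, continuous g2}.

Lemma partial_compE x i : D x ->
  partial i (fun y => g (f y)) x = g1 (f x) * partial i f x.
Proof.
by move=> Dx; apply: partial_comp; [have [_ + _ _ _] := hf Dx; exact|exact: dg].
Qed.

Let nearE x i : D x -> \forall y \near x,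
  g1 (f y) * partial i f y = partial i (fun y => g (f y)) y.
Proof.
move=> Dx; have nD : \forall y \near x, D y by exact: open_nbhs_nbhs.
by apply: filterS nD => y Dy; rewrite partial_compE.
Qed.

Let is_derive_partial_comp x i j : D x ->
  is_derive x (delta_mx 0 j) (partial i (fun y => g (f y)))
    (g2 (f x) * partial j f x * partial i f x + g1 (f x) * partial j (partial i f) x).
Proof.
move=> Dx; apply: (near_eq_is_derive (nearE i Dx)).
have [_ d1 _ d2 _] := hf Dx.
have H1 := is_derive_comp_dir (derivableP (d1 j)) (dg1 Dx).
have H2 := derivableP (d2 i j).
apply: (is_derive_eq (is_deriveM H1 H2)).
by rewrite /GRing.scale /= addrC; congr (_ + _); rewrite mulrC.
Qed.

Lemma partial2_compE x i j : D x ->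
  partial j (partial i (fun y => g (f y))) x =
  g2 (f x) * partial j f x * partial i f x + g1 (f x) * partial j (partial i f) x.
Proof. by move=> Dx; have [] := is_derive_partial_comp i j Dx. Qed.

Lemma C2_on_comp : C2_on D (fun y => g (f y)).
Proof.
move=> x Dx; have [c0 d1 c1 d2 c2] := hf Dx.
have cg (k dk : R -> R) : is_derive (f x) 1 k (dk (f x)) ->
    {for f x, continuous k}.
  by move=> [dk1 _]; apply/differentiable_continuous/derivable1_diffP.
have cg0 := cg _ _ (dg Dx).
have cg1 := cg _ _ (dg1 Dx).
have nD : \forall y \near x, D y by exact: open_nbhs_nbhs.
have lim k : {for f x, continuous k} -> k (f y) @[y --> x] --> k (f x).
  by move=> ck; apply: cvg_comp; [exact: c0|exact: ck].
split.
- exact: lim.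
- by move=> i; have [] := is_derive_comp_dir (derivableP (d1 i)) (dg Dx).
- move=> i; rewrite /prop_for /continuous_at partial_compE //.
  apply: cvg_trans; first exact: near_eq_cvg (nearE i Dx).
  by apply: cvgM; [exact: lim|exact: c1].
- by move=> i j; have [] := is_derive_partial_comp i j Dx.
- move=> i j; rewrite /prop_for /continuous_at partial2_compE //.
  have E : {near x, (fun y => g2 (f y) * partial j f y * partial i f y +
       g1 (f y) * partial j (partial i f) y) =1
       (fun y => partial j (partial i (fun y => g (f y))) y)}.
    by apply: filterS nD => y Dy; rewrite partial2_compE.
  apply: cvg_trans (near_eq_cvg E) _.
  apply: (@cvgD _ _ _ _ _ _ _ (g2 (f x) * partial j f x * partial i f x)).
    apply: (@cvgM _ _ _ _ _ _ (g2 (f x) * partial j f x)); last exact: c1.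
    by apply: (@cvgM _ _ _ _ _ _ (g2 (f x))); [apply: lim; exact: cg2|exact: c1].
  by apply: (@cvgM _ _ _ _ _ _ (g1 (f x))); [exact: lim|exact: c2].
Qed.

End Composition.
End C2.

(** * Continuity and convex sets *)

Section Continuity.
Context {R : realType}.

Lemma continuous_homothety (V : normedModType R) (w : V) (k : R) :
  continuous (fun x : V => k *: x + w).
Proof.
move=> x; apply: cvgD; last exact: cvg_cst.
by apply: cvgZ; [exact: cvg_cst|exact: cvg_id].
Qed.

Lemma continuous_quotient (T : topologicalType) (f g : T -> R) (x : T) :
  {for x, continuous f} -> {for x, continuous g} -> g x != 0 ->
  {for x, continuous (fun y => f y / g y)}.
Proof. by move=> cf cg gx; apply: cvgM => //; exact: cvgV. Qed.

Lemma continuous_conv (V : normedModType R) (l r : R) :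
  continuous (fun x : V * V => l *: x.1 + r *: x.2).
Proof.
move=> x; apply: cvgD.
  by apply: cvgZ; [exact: cvg_cst|exact: cvg_fst].
by apply: cvgZ; [exact: cvg_cst|exact: cvg_snd].
Qed.

Lemma continuous_comp_fun (S T U : topologicalType) (f : S -> T) (g : T -> U) :
  continuous f -> continuous g -> continuous (fun x => g (f x)).
Proof. by move=> cf cg x; apply: cvg_comp; [exact: cf|exact: cg]. Qed.

Lemma continuous_at_sub (T : topologicalType) (f g : T -> R) (x : T) :
  {for x, continuous f} -> {for x, continuous g} ->
  {for x, continuous (fun y => f y - g y)}.
Proof. by move=> cf cg; exact: cvgB. Qed.

Lemma continuous_at_mul (T : topologicalType) (f g : T -> R) (x : T) :
  {for x, continuous f} -> {for x, continuous g} ->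
  {for x, continuous (fun y => f y * g y)}.
Proof. by move=> cf cg; exact: cvgM. Qed.

Lemma continuous_at_cst (T : topologicalType) (x : T) (k : R) :
  {for x, continuous (fun _ : T => k)}.
Proof. exact: cvg_cst. Qed.

Lemma continuous_at_comp (T U : topologicalType) (g : R -> U) (f : T -> R) (x : T) :
  {for x, continuous f} -> {for f x, continuous g} ->
  {for x, continuous (fun y => g (f y))}.
Proof. by move=> cf cg; apply: cvg_comp; [exact: cf|exact: cg]. Qed.

Lemma continuous_at_translate (V : normedModType R) (f : V -> R) (w y : V) :
  {for w + y, continuous f} -> {for y, continuous (fun x => f (w + x))}.
Proof.
move=> cf; apply: (@cvg_comp _ _ _ (fun x : V => w + x) f _ (nbhs (w + y))); last exact: cf.
by apply: cvgD; [exact: cvg_cst|exact: cvg_id].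
Qed.

Lemma continuous_sum_at (T : topologicalType) (m : nat)
    (f : 'I_m -> T -> R) (y : T) :
  (forall i, {for y, continuous (f i)}) -> {for y, continuous (fun y => \sum_(i < m) f i y)}.
Proof.
move=> cf; elim: (index_enum 'I_m) => [|i s IH].
  rewrite (_ : (fun _ => _) = (fun _ => 0)); first exact: cvg_cst.
  by apply/funext => w; rewrite big_nil.
rewrite (_ : (fun _ => _) = (fun w => f i w + \sum_(j <- s) f j w)).
  by apply: cvgD; [exact: cf|exact: IH].
by apply/funext => w; rewrite big_cons.
Qed.

Lemma continuous_at_eps (T : topologicalType) (f : T -> R) (x : T) :
  (forall e : R, 0 < e -> \forall y \near x, `|f y - f x| < e) -> {for x, continuous f}.
Proof.
move=> h; apply/cvgrPdist_lt => e e0.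
by apply: filterS (h e e0) => y; rewrite distrC.
Qed.

End Continuity.

Section ConvexSets.
Context {R : realType} {n : nat}.
Implicit Types (D : set 'rV[R]_n).

(** Convexity with a real parameter constrained by inequalities, in place of a
parameter in a type of interval values. *)
Definition segment_convex D := forall x y (l : R), D x -> D y -> 0 <= l <= 1 ->
  D (l *: x + (1 - l) *: y).

Lemma bounded_closure_compact D : bounded_set D -> compact (closure D).
Proof.
move=> [M [_ hM]]; apply: bounded_closed_compact; last exact: closed_closure.
have sub : closure D `<=` [set x | `|x| <= M + 1].
  rewrite closureE; apply: smallest_sub.
    rewrite (_ : mkset _ = (fun x : 'rV[R]_n => `|x|) @^-1` [set r : R | r <= M + 1]) //.
    apply: preimage_closed; last exact: closed_le.
    by move=> y _; exact: norm_continuous.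
  by move=> x Dx; apply: hM => //; rewrite ltrDl.
exists (M + 1); split; first exact: num_real.
by move=> N MN x /sub /= xM; exact: le_trans xM (ltW MN).
Qed.

(** A point of the closure is approximated by [w] in [D]; the error is absorbed by
moving [x] slightly, which is possible because [l > 0] and [D] is open. *)
Lemma conv_closure_open D x y (l : R) : open D -> segment_convex D ->
  D x -> closure D y -> 0 < l < 1 -> D (l *: x + (1 - l) *: y).
Proof.
move=> oD cD Dx cy /andP[l0 l1].
have [d d0 hd] := @near_norm_ball R _ D x (open_nbhs_nbhs (conj oD Dx)).
have r0 : 0 < 1 - l by rewrite subr_gt0.
have [w [Dw hw]] : D `&` ball y (d * (l / (1 - l))) !=set0.
  by apply: cy; apply: nbhsx_ballx; rewrite mulr_gt0 // divr_gt0.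
move: hw; rewrite -ball_normE /ball_ /= => hw.
have -> : l *: x + (1 - l) *: y =
    l *: (((1 - l) / l) *: (y - w) + x) + (1 - l) *: w.
  rewrite scalerDr scalerA mulrCA divff ?gt_eqF // mulr1 scalerBr.
  by rewrite -addrA addrC -!addrA; congr (_ + _); rewrite addrC subrK.
apply: cD => //; last by rewrite !ltW.
apply: hd; rewrite normrZ gtr0_norm ?divr_gt0 //.
by rewrite mulrC -ltr_pdivlMr ?divr_gt0 // invf_div.
Qed.

End ConvexSets.

(** * Concavity of the exponential of the solution *)

Section LogSolution.
Context {R : realType} {n : nat}.
Variables (Om : set 'rV[R]_n) (z : 'rV[R]_n -> R) (c : R).

(** The exponential of [z], extended by zero; its continuity on the whole space
expresses that [z] tends to minus infinity at the boundary. *)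
Definition exp_on (x : 'rV[R]_n) : R := if `[< Om x >] then expR (z x) else 0.
Local Notation V := exp_on.

Lemma exp_onE x : Om x -> V x = expR (z x).
Proof. by move=> h; rewrite /exp_on; case: asboolP. Qed.

Lemma exp_on_out x : ~ Om x -> V x = 0.
Proof. by move=> h; rewrite /exp_on; case: asboolP. Qed.

Lemma exp_on_ge0 x : 0 <= V x.
Proof. by rewrite /exp_on; case: ifP => // _; exact: expR_ge0. Qed.

Lemma exp_on_gt0 x : Om x -> 0 < V x.
Proof. by move=> /exp_onE ->; exact: expR_gt0. Qed.

Lemma exp_on_gt0_in x : 0 < V x -> Om x.
Proof. by rewrite /exp_on; case: asboolP => //; rewrite ltxx. Qed.

Definition sqgrad x : R := \sum_(i < n) partial i z x ^+ 2.

Hypothesis oOm : open Om.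
Hypothesis bOm : bounded_set Om.
Hypothesis cOm : segment_convex Om.
Hypothesis zC2 : C2_on Om z.
Hypothesis zpde : forall x, Om x ->
  laplacian z x = (c - 1) * sqgrad x - c * expR (z x) ^- 2.
Hypothesis c0 : 0 < c.
Hypothesis cV : continuous V.

Lemma jet2_coord x e : Om x ->
  jet2 (fun t => z (t *: e + x)) (grad_dir z x e) (hess_form z x e e).
Proof. exact: jet2_C2. Qed.

Lemma jet2_exp x e : Om x ->
  jet2 (fun t => V (t *: e + x)) (V x * grad_dir z x e)
    (V x * (hess_form z x e e + grad_dir z x e ^+ 2)).
Proof.
move=> Ox; have := jet2_expR (jet2_coord e Ox); rewrite scale0r add0r -exp_onE //.
apply: jet2_near.
have nO : \forall y \near x, Om y by exact: open_nbhs_nbhs.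
by apply: filterS (@near_line _ _ _ _ e nO) => t Ot; rewrite exp_onE.
Qed.

(** Comparison of [z] with its pullback under the homothety
[A x = l x1 + (1 - l) x], which maps the closure of the domain into the domain.
The quotient [V x / V (A x)] is continuous on the closure, so it has a maximum;
there the gradient terms of the two equations cancel, and what remains bounds
the maximum by [1 / (1 - l)]. *)
Lemma star_shaped x1 x3 (l : R) : Om x1 -> Om x3 -> 0 < l < 1 ->
  (1 - l) * V x3 <= V (l *: x1 + (1 - l) *: x3).
Proof.
move=> O1 O3 l01; rewrite leNgt; apply/negP => hlt.
have r0 : 0 < 1 - l by rewrite subr_gt0; case/andP: l01.
pose A (x : 'rV[R]_n) : 'rV[R]_n := l *: x1 + (1 - l) *: x.
have OA x : closure Om x -> Om (A x) by move=> cx; exact: conv_closure_open.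
pose G x := V x / V (A x).
have cA : continuous A.
  have -> : A = (fun x => (1 - l) *: x + l *: x1).
    by apply/funext => x; rewrite /A addrC.
  exact: continuous_homothety.
have [|||m] := @EVT_max_rV R n G (closure Om).
- by exists x3; exact: subset_closure.
- exact: bounded_closure_compact.
- rewrite continuous_subspace_in => x; rewrite inE => cx.
  apply: continuous_subspaceT_for => //.
  apply: continuous_quotient; [exact: cV|exact: (continuous_comp_fun cA cV)|].
  by rewrite gt_eqF // exp_on_gt0 //; exact: OA.
rewrite inE => cm maxm.
have G3 : (1 - l)^-1 < G m.
  apply: (@lt_le_trans _ _ (G x3)).
    rewrite /G ltr_pdivlMr; last by apply: exp_on_gt0; exact/OA/subset_closure.
    by rewrite mulrC ltr_pdivrMr // mulrC.
  by apply: maxm; rewrite inE; exact: subset_closure.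
have OAm := OA _ cm.
have Om_ : Om m.
  apply: exp_on_gt0_in.
  have : 0 < G m by apply: lt_trans G3; rewrite invr_gt0.
  by rewrite /G pmulr_lgt0 // invr_gt0 exp_on_gt0.
have nO : \forall y \near m, Om y by exact: open_nbhs_nbhs.
have key i : (1 - l) * partial i z (A m) = partial i z m /\
    partial i (partial i z) m <= (1 - l) ^+ 2 * partial i (partial i z) (A m).
  pose e : 'rV[R]_n := delta_mx 0 i.
  have [] := @jet2_min R (fun t => z (t *: ((1 - l) *: e) + A m) - z (t *: e + m))
    _ _ _ (jet2B (jet2_coord ((1 - l) *: e) OAm) (jet2_coord e Om_)).
    apply: filterS (@near_line _ _ _ _ e nO) => t Ot.
    have AE : A (t *: e + m) = t *: ((1 - l) *: e) + A m.
      rewrite /A scalerDr addrCA; congr (_ + _).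
      by rewrite !scalerA mulrC.
    have := maxm (t *: e + m); rewrite inE => /(_ (subset_closure Ot)).
    rewrite /G AE ler_pdivrMr; last by rewrite -AE exp_on_gt0 //; exact/OA/subset_closure.
    rewrite !scale0r !add0r.
    rewrite !exp_onE //; last by rewrite -AE; exact/OA/subset_closure.
    by rewrite -expRN -!expRD ler_expR; lra.
  rewrite !grad_dirZ !hess_formZ !grad_dir_delta !hess_form_delta => h1 h2.
  by split; [apply/eqP; rewrite -subr_eq0 h1|rewrite -subr_ge0].
have hS : sqgrad m = (1 - l) ^+ 2 * sqgrad (A m).
  rewrite /sqgrad mulr_sumr; apply: eq_bigr => i _.
  by case: (key i) => <- _; rewrite exprMn.
have hL : laplacian z m <= (1 - l) ^+ 2 * laplacian z (A m).
  by rewrite /laplacian mulr_sumr; apply: ler_sum => i _; case: (key i).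
move: hL; rewrite !zpde // hS => hL.
have hE : (1 - l) ^+ 2 * expR (z (A m)) ^- 2 <= expR (z m) ^- 2.
  have : c * ((1 - l) ^+ 2 * expR (z (A m)) ^- 2) <= c * expR (z m) ^- 2 by lra.
  by rewrite ler_pM2l.
have : (1 - l) * expR (z m) <= expR (z (A m)).
  move: hE; rewrite -!exprVn -exprMn.
  rewrite ler_pXn2r ?nnegrE ?mulr_ge0 ?invr_ge0 ?expR_ge0 ?(ltW r0) //.
  by rewrite ler_pdivrMr ?expR_gt0 // mulrC ler_pdivlMr ?expR_gt0.
rewrite leNgt => /negP; apply.
move: G3; rewrite /G !exp_onE // ltr_pdivlMr ?expR_gt0 //.
by rewrite mulrC ltr_pdivrMr // mulrC.
Qed.

Lemma star_shaped_closure x1 x3 (l : R) : closure Om x1 -> Om x3 -> 0 < l < 1 ->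
  (1 - l) * V x3 <= V (l *: x1 + (1 - l) *: x3).
Proof.
move=> c1 O3 l01.
suff : closure Om `<=` [set x | (1 - l) * V x3 <= V (l *: x + (1 - l) *: x3)] by exact.
rewrite closureE; apply: smallest_sub; last by move=> x Ox; exact: star_shaped.
pose A (x : 'rV[R]_n) : 'rV[R]_n := l *: x + (1 - l) *: x3.
rewrite (_ : mkset _ = (fun x => V (A x)) @^-1` [set r : R | (1 - l) * V x3 <= r]) //.
apply: preimage_closed; last exact: closed_ge.
move=> y _; apply: (@continuous_comp_fun _ _ _ A V) => //.
exact: continuous_homothety.
Qed.

(** First and second order conditions at a minimum of the two-point function. The
points x1 and x3 move along [e] with speeds [s] and [t], and x2 with the speed
[l s + (1 - l) t]; since the speeds are free, one gets more than the mere
inequality between Hessians. *)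
Lemma conv_min_jet x1 x3 (l k : R) e :
  Om x1 -> Om x3 -> 0 < l < 1 ->
  (forall y1 y3, Om y1 -> Om y3 ->
    k * V (l *: x1 + (1 - l) *: x3) - l * V x1 - (1 - l) * V x3 <=
    k * V (l *: y1 + (1 - l) *: y3) - l * V y1 - (1 - l) * V y3) ->
  let x2 := l *: x1 + (1 - l) *: x3 in
  let d x := V x * grad_dir z x e in
  let d2 x := V x * (hess_form z x e e + grad_dir z x e ^+ 2) in
  d x1 = k * d x2 /\ d x3 = k * d x2 /\
  forall s t, 0 <= k * (l * s + (1 - l) * t) ^+ 2 * d2 x2 -
     l * s ^+ 2 * d2 x1 - (1 - l) * t ^+ 2 * d2 x3.
Proof.
move=> O1 O3 /andP[l0 l1] hm x2 d d2.
have O2 : Om x2 by apply: cOm => //; rewrite !ltW.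
have key s t :
    k * ((l * s + (1 - l) * t) * d x2) - l * (s * d x1) - (1 - l) * (t * d x3) = 0
    /\ 0 <= k * ((l * s + (1 - l) * t) ^+ 2 * d2 x2) - l * (s ^+ 2 * d2 x1)
           - (1 - l) * (t ^+ 2 * d2 x3).
  have J1 := jet2Z l (jet2_scale s (jet2_exp e O1)).
  have J3 := jet2Z (1 - l) (jet2_scale t (jet2_exp e O3)).
  have J2 := jet2Z k (jet2_scale (l * s + (1 - l) * t) (jet2_exp e O2)).
  apply: jet2_min (jet2B (jet2B J2 J1) J3).
  have n1 : \forall y \near x1, Om y by exact: open_nbhs_nbhs.
  have n3 : \forall y \near x3, Om y by exact: open_nbhs_nbhs.
  have m1 := @near_line _ _ _ _ (s *: e) n1.
  have m3 := @near_line _ _ _ _ (t *: e) n3.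
  apply: filterS2 m1 m3 => r; rewrite !scalerA ![r * _]mulrC => h1 h3.
  rewrite !mulr0 !scale0r !add0r.
  apply: (le_trans (hm _ _ h1 h3)).
  rewrite le_eqVlt; apply/orP; left; apply/eqP; congr (k * V _ - _ - _).
  by apply/rowP => j; rewrite /x2 !mxE; ring.
have [h1 _] := key 1 0; have [h3 _] := key 0 1.
have l0' : l != 0 by rewrite gt_eqF.
have r0' : 1 - l != 0 by rewrite gt_eqF // subr_gt0.
split; last split.
- by apply: (mulfI l0'); lra.
- by apply: (mulfI r0'); lra.
- by move=> s t; have [_] := key s t; rewrite !mulrA.
Qed.

(** The second order conditions summed over the coordinates, after the equation has
been inserted: [p] is the common squared gradient at x1 and x3, and [p / k^2] is
the one at x2. If [p > 1] the point x2 is kept fixed; if [p <= 1] the speeds are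
taken proportional to the values, which turns the condition into a comparison
of [v2] with the convex combination of [v1] and [v3]. *)
Lemma conv_min_absurd (l k p v1 v2 v3 : R) :
  0 < l < 1 -> 1 < k -> 0 < v1 -> 0 < v2 -> 0 < v3 ->
  k * v2 < l * v1 + (1 - l) * v3 ->
  (forall s t, 0 <= k * (l * s + (1 - l) * t) ^+ 2 * ((p / k ^+ 2 - 1) / v2) -
     l * s ^+ 2 * ((p - 1) / v1) - (1 - l) * t ^+ 2 * ((p - 1) / v3)) -> False.
Proof.
move=> /andP[l0 l1] k1 v10 v20 v30 hM H.
have r0 : 0 < 1 - l by lra.
have k0 : 0 < k by lra.
have [p1|p1] := lerP p 1; last first.
  (* these speeds leave x2 at rest *)
  have := H (1 - l) (- l).
  have -> : l * (1 - l) + (1 - l) * (- l) = 0 by ring.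
  rewrite expr0n /= mulr0 mul0r sub0r => h.
  have q1 : 0 < l * (1 - l) ^+ 2 * ((p - 1) / v1).
    by rewrite !mulr_gt0 ?exprn_gt0 ?invr_gt0 // subr_gt0.
  have q3 : 0 < (1 - l) * (- l) ^+ 2 * ((p - 1) / v3).
    by rewrite sqrrN !mulr_gt0 ?exprn_gt0 ?invr_gt0 // subr_gt0.
  lra.
pose M := l * v1 + (1 - l) * v3.
have M0 : 0 < M by rewrite addr_gt0 // mulr_gt0.
have := H v1 v3; rewrite -/M.
have -> : k * M ^+ 2 * ((p / k ^+ 2 - 1) / v2) - l * v1 ^+ 2 * ((p - 1) / v1)
    - (1 - l) * v3 ^+ 2 * ((p - 1) / v3)
  = M * ((1 - p) - M * (k ^+ 2 - p) / (k * v2)).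
  by rewrite /M; field; rewrite !gt_eqF.
rewrite pmulr_rge0 // subr_ge0 ler_pdivrMr ?mulr_gt0 // => h.
have kp : 0 < k ^+ 2 - p by rewrite subr_gt0; apply: le_lt_trans p1 _; rewrite exprn_egt1.
have : k * v2 * (k ^+ 2 - p) < M * (k ^+ 2 - p) by rewrite ltr_pM2r.
have : (1 - p) * (k * v2) < (k ^+ 2 - p) * (k * v2).
  rewrite ltr_pM2r ?mulr_gt0 // ltrD2r exprn_egt1 //.
lra.
Qed.

Lemma laplacian_exp_on x : Om x ->
  \sum_(i < n) V x * (hess_form z x (delta_mx 0 i) (delta_mx 0 i) +
                     grad_dir z x (delta_mx 0 i) ^+ 2) =
  c * ((\sum_(i < n) (V x * grad_dir z x (delta_mx 0 i)) ^+ 2 - 1) / V x).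
Proof.
move=> Ox; have V0 : V x != 0 by rewrite gt_eqF // exp_on_gt0.
have -> : \sum_(i < n) (V x * grad_dir z x (delta_mx 0 i)) ^+ 2 = V x ^+ 2 * sqgrad x.
  rewrite /sqgrad mulr_sumr; apply: eq_bigr => i _.
  by rewrite grad_dir_delta exprMn.
rewrite -mulr_sumr big_split /=.
have -> : \sum_(i < n) hess_form z x (delta_mx 0 i) (delta_mx 0 i) = laplacian z x.
  by apply: eq_bigr => i _; rewrite hess_form_delta.
have -> : \sum_(i < n) grad_dir z x (delta_mx 0 i) ^+ 2 = sqgrad x.
  by apply: eq_bigr => i _; rewrite grad_dir_delta.
rewrite zpde // -exp_onE //.
by field.
Qed.

(** A negative minimum of the two-point function is attained, as [V] is continuous
on a compact set. If x1 or x3 lies on the boundary, [star_shaped] contradicts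
negativity; otherwise [conv_min_absurd] applies. *)
Lemma almost_concave x1 x3 (l k : R) : Om x1 -> Om x3 -> 0 < l < 1 -> 1 < k ->
  l * V x1 + (1 - l) * V x3 <= k * V (l *: x1 + (1 - l) *: x3).
Proof.
move=> O1 O3 l01 k1; rewrite leNgt; apply/negP => hlt.
have [l0 l1] := andP l01.
have r0 : 0 < 1 - l by lra.
have k0 : 0 < k by lra.
pose F (x : 'rV[R]_n * 'rV[R]_n) := k * V (l *: x.1 + (1 - l) *: x.2) - l * V x.1 - (1 - l) * V x.2.
have cF : continuous F.
  have c1 : continuous (fun x : 'rV[R]_n * 'rV[R]_n => V x.1).
    by apply: (continuous_comp_fun _ cV) => x; exact: cvg_fst.
  have c2 : continuous (fun x : 'rV[R]_n * 'rV[R]_n => V x.2).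
    by apply: (continuous_comp_fun _ cV) => x; exact: cvg_snd.
  have c3 : continuous (fun x : 'rV[R]_n * 'rV[R]_n => V (l *: x.1 + (1 - l) *: x.2)).
    apply: (continuous_comp_fun _ cV) => x; exact: continuous_conv.
  move=> x; apply: cvgB; [apply: cvgB|]; apply: cvgM; try exact: cvg_cst.
  - exact: c3.
  - exact: c1.
  - exact: c2.
have K := bounded_closure_compact bOm.
have [|||[m1 m3]] := @compact_EVT_min _ R F (closure Om `*` closure Om).
- by exists (x1, x3); split; exact: subset_closure.
- exact: compact_setX.
- exact: continuous_subspaceT.
rewrite inE => -[/= cm1 cm3] minF.
have F0 : F (m1, m3) < 0.
  apply: (@le_lt_trans _ _ (F (x1, x3))).
    by apply: minF; rewrite inE; split; exact: subset_closure.
  by rewrite /F /=; lra.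
have V2 := exp_on_ge0 (l *: m1 + (1 - l) *: m3).
have kV : 0 <= (k - 1) * V (l *: m1 + (1 - l) *: m3) by rewrite mulr_ge0 // subr_ge0 ltW.
have Om1 : Om m1.
  apply: contrapT => N1; move: F0; rewrite /F /= (exp_on_out N1) mulr0 subr0.
  have [in3|N3] := pselect (Om m3).
    have := star_shaped_closure cm1 in3 l01; lra.
  rewrite (exp_on_out N3); lra.
have Om3 : Om m3.
  apply: contrapT => N3; move: F0; rewrite /F /= (exp_on_out N3) mulr0 subr0.
  have r01 : 0 < 1 - l < 1 by lra.
  have := star_shaped_closure cm3 Om1 r01.
  have -> : 1 - (1 - l) = l by ring.
  rewrite [(1 - l) *: m3 + _]addrC; lra.
have Om2 : Om (l *: m1 + (1 - l) *: m3) by apply: cOm => //; lra.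
have J i := @conv_min_jet m1 m3 l k (delta_mx 0 i) Om1 Om3 l01.
have {}J i := J i (fun y1 y3 h1 h3 => minF (y1, y3)
  (mem_set (conj (subset_closure h1) (subset_closure h3)))).
set m2 := l *: m1 + (1 - l) *: m3 in Om2 V2 kV J F0 *.
pose p := \sum_(i < n) (V m1 * grad_dir z m1 (delta_mx 0 i)) ^+ 2.
have p3 : \sum_(i < n) (V m3 * grad_dir z m3 (delta_mx 0 i)) ^+ 2 = p.
  by apply: eq_bigr => i _; case: (J i) => -> [-> _].
have p2 : \sum_(i < n) (V m2 * grad_dir z m2 (delta_mx 0 i)) ^+ 2 = p / k ^+ 2.
  rewrite /p mulr_suml; apply: eq_bigr => i _; case: (J i) => -> _.
  by field; rewrite gt_eqF.
apply: (@conv_min_absurd l k p (V m1) (V m2) (V m3)) => //; try exact: exp_on_gt0.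
  by move: F0; rewrite /F /= -/m2; lra.
move=> s t; rewrite -p2 -{2}p3 {1}/p -(pmulr_rge0 _ c0).
have dist (a1 a2 a3 b1 b2 b3 : R) : c * (a1 * b1 - a2 * b2 - a3 * b3) =
    a1 * (c * b1) - a2 * (c * b2) - a3 * (c * b3) by ring.
rewrite dist -!laplacian_exp_on //.
rewrite !mulr_sumr -!sumrB; apply: sumr_ge0 => i _.
by case: (J i) => _ [_].
Qed.

Lemma exp_on_concave x1 x3 (l : R) : Om x1 -> Om x3 -> 0 < l < 1 ->
  l * V x1 + (1 - l) * V x3 <= V (l *: x1 + (1 - l) *: x3).
Proof.
move=> O1 O3 l01; have /andP[l0 l1] := l01.
set x2 := l *: x1 + (1 - l) *: x3.
have V2 : 0 < V x2 by apply: exp_on_gt0; apply: cOm => //; rewrite !ltW.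
apply/ler_addgt0Pr => e e0.
have k1 : 1 < 1 + e / V x2 by rewrite ltrDl divr_gt0.
have := almost_concave O1 O3 l01 k1.
by rewrite -/x2 [X in _ <= X]mulrDl mul1r divfK ?gt_eqF.
Qed.

End LogSolution.

(** * Elementary inequalities *)

Section Elementary.
Context {R : realType}.

Lemma expR_ge_quadratic (r : R) : -2 <= r -> 1 + r + r ^+ 2 / 4 <= expR r.
Proof.
move=> r2.
have -> : expR r = expR (r / 2) ^+ 2 by rewrite -expRM_natl mulrC divfK.
have -> : 1 + r + r ^+ 2 / 4 = (1 + r / 2) ^+ 2 by field.
by rewrite ler_sqr ?nnegrE ?expR_ge0 ?expR_ge1Dx //; lra.
Qed.

Lemma expRN2_le_quadratic (r : R) : - (1 / 4) <= r ->
  expR r ^- 2 <= 1 - 2 * r + 8 * r ^+ 2.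
Proof.
move=> r4; rewrite -expRM_natl.
have h : 1 + 2 * r <= expR (2 * r) by exact: expR_ge1Dx.
have p : 0 < 1 + 2 * r by lra.
apply: (@le_trans _ _ (1 + 2 * r)^-1).
  by rewrite lef_pV2 ?posrE ?expR_gt0.
rewrite -[X in X <= _]mul1r ler_pdivrMr //.
have : 0 <= r ^+ 2 * (1 + 4 * r) by rewrite mulr_ge0 ?sqr_ge0 //; lra.
by lra.
Qed.

(** Here [r] and [s] are the increments of z between a point and two opposite
neighbours, so that the hypothesis on the exponentials is midpoint concavity of
v. The quadratic term in the lower bound of the exponential lets the second
difference [- (r + s)] control the squares of the increments, hence also the
second difference of [e^(-2z)], whose convexity has the wrong sign. *)
Lemma exp_second_difference (r s : R) :
  - (1 / 4) <= r -> - (1 / 4) <= s -> expR r + expR s <= 2 ->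
  (r ^+ 2 + s ^+ 2) / 4 <= - (r + s) /\
  expR r ^- 2 + expR s ^- 2 - 2 <= 34 * (- (r + s)).
Proof.
move=> r4 s4 rs.
have hr := @expR_ge_quadratic r ltac:(lra).
have hs := @expR_ge_quadratic s ltac:(lra).
have h1 : (r ^+ 2 + s ^+ 2) / 4 <= - (r + s) by lra.
split => //.
have := expRN2_le_quadratic r4; have := expRN2_le_quadratic s4.
by lra.
Qed.

Lemma sqr_second_difference (a b d : R) :
  2 * a ^+ 2 - b ^+ 2 - d ^+ 2 <= 2 * a * (2 * a - b - d).
Proof. by have := sqr_ge0 (b - a); have := sqr_ge0 (d - a); rewrite !sqrrB; lra. Qed.

(** The final elimination in [touching_inequality], where S, Sp, Sm stand for the
squared gradients and Y, Yp, Ym for the values of [e^(-2z)] at the three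
points. *)
Lemma touching_algebra (c eps E al q N S Sp Sm Y Yp Ym B : R) :
  eps * ((4 * al ^+ 2 * q - 2 * al * N) * E) <=
    2 * ((c - 1) * S - c * Y) - ((c - 1) * Sp - c * Yp) - ((c - 1) * Sm - c * Ym) ->
  (c - 1) * (2 * S - Sp - Sm) <= (c - 1) * (eps * (4 * al * B * E)) ->
  c * (Yp + Ym - 2 * Y) <= c * (Y * (34 * (eps * E))) ->
  (4 * al ^+ 2 * q - 2 * al * N) * (eps * E) <=
  (4 * (c - 1) * al * B + 34 * c * Y) * (eps * E).
Proof. lra. Qed.

(** For a large exponent the quadratic term in [al] coming from the Laplacian of the
barrier beats all the others on the region [r2 < q]. *)
Lemma barrier_dominates (c al r2 B Eb b y q N : R) :
  1 <= c -> 1 <= al -> 0 <= Eb -> b <= B -> y <= Eb ->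
  2 * N + 4 * (c - 1) * B + 34 * c * Eb < 4 * r2 * al -> r2 < q ->
  4 * (c - 1) * al * b + 34 * c * y < 4 * al ^+ 2 * q - 2 * al * N.
Proof.
move=> c1 al1 E0 bB yE hC rq.
have al0 : 0 < al by lra.
have h1 : 4 * (c - 1) * al * b <= 4 * (c - 1) * al * B.
  by apply: ler_wpM2l => //; rewrite !mulr_ge0 //; lra.
have h2 : 34 * c * y <= 34 * c * Eb by apply: ler_wpM2l => //; lra.
have h3 : 34 * c * Eb <= al * (34 * c * Eb).
  by rewrite ler_peMl // !mulr_ge0 //; lra.
have h4 : 4 * r2 * al < 4 * q * al by rewrite ltr_pM2r // ltr_pM2l.
have h5 : al * (2 * N + 4 * (c - 1) * B + 34 * c * Eb) < al * (4 * q * al).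
  by rewrite ltr_pM2l //; exact: lt_trans h4.
lra.
Qed.

End Elementary.

(** * Euclidean balls and an exponential barrier *)

Section SupNorm.
Context {R : realType} {n : nat}.
Implicit Types x : 'rV[R]_n.

Lemma coord_le_norm x i : `|x 0 i| <= `|x|.
Proof.
rewrite [leRHS]/Num.norm /= mx_normrE; apply/bigmax_geP; right => /=.
by exists (0, i).
Qed.

Lemma norm_le_coord x (r : R) : 0 <= r -> (forall i, `|x 0 i| <= r) -> `|x| <= r.
Proof.
move=> r0 h; rewrite [leLHS]/Num.norm /= mx_normrE; apply/bigmax_leP; split => //.
by move=> [i j] _ /=; rewrite ord1.
Qed.

(** The squared Euclidean distance. The norm of the ambient space is the maximum
norm, which is not smooth enough for a barrier. *)
Definition sqdist (x y : 'rV[R]_n) : R := \sum_(i < n) (y 0 i - x 0 i) ^+ 2.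

Lemma sqdist_ge0 x y : 0 <= sqdist x y.
Proof. by apply: sumr_ge0 => i _; exact: sqr_ge0. Qed.

Lemma sqdist_norm x y (r : R) : 0 <= r -> sqdist x y <= r ^+ 2 -> `|y - x| <= r.
Proof.
move=> r0 h; apply: norm_le_coord => // i; rewrite !mxE.
rewrite -(ler_pXn2r (n := 2)) ?nnegrE // -normrX ger0_norm ?sqr_ge0 //.
apply: le_trans h; rewrite /sqdist (bigD1 i) //= lerDl.
by apply: sumr_ge0 => j _; exact: sqr_ge0.
Qed.

Lemma norm_sqdist x y (r : R) : (0 < n)%N -> `|y - x| <= r / n%:R ->
  sqdist x y <= r ^+ 2.
Proof.
move=> n0 h; have n0' : (0 : R) < n%:R by rewrite ltr0n.
have n1 : (1 : R) <= n%:R by rewrite ler1n.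
have r0 : 0 <= r.
  by have := le_trans (normr_ge0 _) h; rewrite pmulr_lge0 // invr_gt0.
apply: (@le_trans _ _ (\sum_(i < n) (r / n%:R) ^+ 2)).
  apply: ler_sum => i _.
  have := coord_le_norm (y - x) i; rewrite !mxE => /le_trans /(_ h) hi.
  rewrite -[X in X <= _]real_normK ?num_real // ler_sqr ?nnegrE //.
  by rewrite divr_ge0 // ltW.
rewrite sumr_const card_ord -[_ *+ n]mulr_natr exprMn exprVn -mulrA.
rewrite ler_piMr ?sqr_ge0 // expr2 invfM -mulrA mulVf ?gt_eqF // mulr1.
by rewrite invf_le1.
Qed.

Lemma continuous_sqdist x : continuous (sqdist x).
Proof.
move=> y; apply: continuous_sum_at => i.
apply: (@continuous_comp_fun _ _ _ (fun y : 'rV[R]_n => y 0 i) (fun r : R => (r - x 0 i) ^+ 2)).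
  exact: coord_continuous.
move=> r; apply: (@cvg_comp _ _ _ (fun r : R => r - x 0 i) (fun r : R => r ^+ 2) _
  (nbhs (r - x 0 i))).
  by apply: cvgB; [exact: cvg_id|exact: cvg_cst].
exact: exprn_continuous.
Qed.

Lemma sqdist_coord x y i (t : R) :
  sqdist x (t *: delta_mx 0 i + y) = sqdist x y + 2 * t * (y 0 i - x 0 i) + t ^+ 2.
Proof.
rewrite /sqdist (bigD1 i) //= [in RHS](bigD1 i) //= !mxE !eqxx mulr1.
have -> : \sum_(j < n | j != i) ((t *: delta_mx 0 i + y) 0 j - x 0 j) ^+ 2 =
          \sum_(j < n | j != i) (y 0 j - x 0 j) ^+ 2.
  by apply: eq_bigr => j ji; rewrite !mxE eqxx (negbTE ji) mulr0 add0r.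
by ring.
Qed.

Lemma compact_sqball x (r : R) : 0 <= r -> compact [set y | sqdist x y <= r ^+ 2].
Proof.
move=> r0; apply: bounded_closed_compact.
  exists (r + `|x|); split; first exact: num_real.
  move=> M hM y /= /(sqdist_norm r0) h.
  by rewrite -(subrK x y) (le_trans (ler_normD _ _)) // ltW // (le_lt_trans _ hM) // lerD2r.
rewrite (_ : mkset _ = sqdist x @^-1` [set s : R | s <= r ^+ 2]) //.
apply: preimage_closed; last exact: closed_le.
by move=> y _; exact: continuous_sqdist.
Qed.

(** Hopf's barrier: for [alpha > 0] it is positive exactly inside the Euclidean ball
of radius [r], and, away from the centre, its Laplacian dominates its gradient
and its values once [alpha] is large. *)
Definition barrier x (alpha r : R) y : R :=
  expR (- alpha * sqdist x y) - expR (- alpha * r ^+ 2).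

Lemma jet2_quadratic (a k : R) : jet2 (fun t => k + 2 * t * a + t ^+ 2) (2 * a) 2.
Proof.
exists (fun t => 2 * a + 2 * t); split.
- near=> t.
  have H1 : is_derive (t : R) 1 (fun s : R => 2 * a * s + s ^+ 2) (2 * a + 2 * t).
    apply: is_deriveD.
      exact: is_derive_mull.
    apply: DeriveDef; first exact: exprn_derivable.
    by rewrite exp_derive /= expr1 [_ *: 1]mulr1.
  have := is_deriveD (is_derive_cst k t 1) H1.
  rewrite add0r; congr is_derive; apply/funext => s /=.
  by rewrite -[LHS]/(k + (2 * a * s + s ^+ 2)); ring.
- by rewrite mulr0 addr0.
- have := is_deriveD (is_derive_cst (2 * a) (0 : R) 1) (is_derive_mull 2 0).
  by rewrite add0r.
Unshelve. all: by end_near. Qed.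

Lemma jet2_barrier x (alpha r : R) (y : 'rV[R]_n) i :
  let d := y 0 i - x 0 i in let E := expR (- alpha * sqdist x y) in
  jet2 (fun t => barrier x alpha r (t *: delta_mx 0 i + y))
    (- (2 * alpha * d * E)) ((4 * alpha ^+ 2 * d ^+ 2 - 2 * alpha) * E).
Proof.
move=> d E.
have J := jet2B (jet2_expR (jet2Z (- alpha) (jet2_quadratic d (sqdist x y))))
   (jet2_cst (expR (- alpha * r ^+ 2))).
apply: (jet2_eq (jet2_near _ J)).
- by near=> t; rewrite /barrier sqdist_coord.
- by rewrite mulr0 mul0r expr0n /= !addr0 -/E; ring.
- by rewrite mulr0 mul0r expr0n /= !addr0 -/E; ring.
Unshelve. all: by end_near. Qed.

Lemma continuous_barrier x (alpha r : R) : continuous (barrier x alpha r).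
Proof.
apply: (@continuous_comp_fun _ _ _ (sqdist x)
  (fun s : R => expR (- alpha * s) - expR (- alpha * r ^+ 2))).
  exact: continuous_sqdist.
move=> s; apply: cvgB; last exact: cvg_cst.
apply: (@continuous_comp_fun _ _ _ (fun s : R => - alpha * s) (@expR R)).
  by move=> w; apply: cvgM; [exact: cvg_cst|exact: cvg_id].
exact: continuous_expR.
Qed.

Lemma compact_upper_bound (K : set 'rV[R]_n) (f : 'rV[R]_n -> R) :
  compact K -> (forall x, K x -> {for x, continuous f}) ->
  exists2 M, 0 <= M & forall x, K x -> f x <= M.
Proof.
move=> cK cf; have [K0|K0] := pselect (K !=set0); last first.
  by exists 0 => // x Kx; case: K0; exists x.
have [|k _ hk] := @EVT_max_rV R n f K K0 cK.
  rewrite continuous_subspace_in => x; rewrite inE => Kx.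
  by apply: continuous_subspaceT_for => //; exact: cf.
exists `|f k| => // x Kx; apply: le_trans (ler_norm _).
by apply: hk; rewrite inE.
Qed.

End SupNorm.

(** * Strict concavity of the logarithm *)

Section Strict.
Context {R : realType} {n : nat}.
Variables (Om : set 'rV[R]_n) (z : 'rV[R]_n -> R) (c : R).
Hypothesis oOm : open Om.
Hypothesis bOm : bounded_set Om.
Hypothesis cOm : segment_convex Om.
Hypothesis zC2 : C2_on Om z.
Hypothesis zpde : forall x, Om x ->
  laplacian z x = (c - 1) * sqgrad z x - c * expR (z x) ^- 2.
Hypothesis c1 : 1 <= c.
Hypothesis cV : continuous (exp_on Om z).
Hypothesis n0 : (0 < n)%N.

Let c0 : 0 < c. Proof. exact: lt_le_trans c1. Qed.

Let V_concave := exp_on_concave oOm bOm cOm zC2 zpde c0 cV.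

Definition second_diff (e : 'rV[R]_n) (h : R) x : R :=
  2 * z x - z (h *: e + x) - z (- h *: e + x).

(** Along a segment of the domain the concave function [exp z] cannot drop by more
than the proportion travelled, here a fifth; this bounds the decrease of [z]
independently of the point. *)
Lemma log_room w x (h h1 : R) : Om x -> Om (h1 *: w + x) -> 0 < h <= h1 / 5 ->
  Om (h *: w + x) /\ - (1 / 4) <= z (h *: w + x) - z x.
Proof.
move=> Ox O1 /andP[h0 hh].
have h10 : 0 < h1 by lra.
pose l := 1 - h / h1.
have hh1 : h / h1 <= 1 / 5 by rewrite ler_pdivrMr // mulrC mulrA mulr1.
have hh0 : 0 < h / h1 by rewrite divr_gt0.
have l01 : 0 < l < 1 by rewrite /l; lra.
have E : h *: w + x = l *: x + (1 - l) *: (h1 *: w + x).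
  rewrite /l subKr scalerDr scalerA divfK ?gt_eqF // addrCA -scalerDl subrK scale1r.
  by [].
have Oh : Om (h *: w + x) by rewrite E; apply: cOm => //; lra.
split => //.
have := V_concave Ox O1 l01; rewrite -E !exp_onE // => hV.
have h2 : 4 / 5 * expR (z x) <= expR (z (h *: w + x)).
  apply: le_trans hV; apply: ler_wpDr; first by rewrite mulr_ge0 ?expR_ge0 //; lra.
  by rewrite ler_wpM2r ?expR_ge0 //; rewrite /l; lra.
have h3 : expR (- (1 / 4)) <= 4 / 5 :> R.
  rewrite expRN.
  have q : 5 / 4 <= expR (1 / 4) :> R by apply: le_trans (expR_ge1Dx _); lra.
  by rewrite -[X in X <= _]mul1r ler_pdivrMr ?expR_gt0 //; lra.
rewrite -ler_expR expRD expRN.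
by rewrite ler_pdivlMr ?expR_gt0 //; apply: le_trans h2; rewrite ler_wpM2r ?expR_ge0.
Qed.

Lemma second_diff_bounds e x (h h1 : R) : Om x -> Om (h1 *: e + x) ->
  Om (- h1 *: e + x) -> 0 < h <= h1 / 5 ->
  let r := z (h *: e + x) - z x in let s := z (- h *: e + x) - z x in
  [/\ Om (h *: e + x), Om (- h *: e + x),
   (r ^+ 2 + s ^+ 2) / 4 <= second_diff e h x &
   expR r ^- 2 + expR s ^- 2 - 2 <= 34 * second_diff e h x].
Proof.
move=> Ox Op Om_ hh r s.
have [Oh rb] := log_room Ox Op hh.
have [Oh' sb] : Om (- h *: e + x) /\ - (1 / 4) <= s.
  have N t : - t *: e = t *: - e by rewrite scaleNr scalerN.
  rewrite /s N; move: Om_; rewrite N => Om_.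
  exact: log_room Ox Om_ hh.
have rs : expR r + expR s <= 2.
  have half : 0 < (1 / 2 : R) < 1 by lra.
  have := V_concave Oh Oh' half.
  have -> : (1 / 2) *: (h *: e + x) + (1 - 1 / 2) *: (- h *: e + x) = x.
    by apply/rowP => j; rewrite !mxE; field.
  rewrite !exp_onE // /r /s !expRD expRN -mulrDl ler_pdivrMr ?expR_gt0 //.
  by lra.
have := exp_second_difference rb sb rs.
have -> : - (r + s) = second_diff e h x by rewrite /r /s /second_diff; ring.
by case.
Qed.

(** The maximum principle at a point where the second difference of [z], lowered by
a multiple of the barrier, has a negative local minimum. The first order
condition turns the difference of the gradient terms of the equation into a drift
term for the barrier, and [second_diff_bounds] handles the exponential terms. *)
Lemma touching_inequality e x x0 (h h1 eps alpha rr : R) :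
  Om x -> Om (h1 *: e + x) -> Om (- h1 *: e + x) -> 0 < h <= h1 / 5 ->
  0 < eps -> 0 < alpha ->
  (\forall y \near x, second_diff e h x - eps * barrier x0 alpha rr x <=
      second_diff e h y - eps * barrier x0 alpha rr y) ->
  second_diff e h x < eps * barrier x0 alpha rr x ->
  4 * alpha ^+ 2 * sqdist x0 x - 2 * alpha * n%:R <=
  4 * (c - 1) * alpha * `|\sum_(i < n) partial i z x * (x 0 i - x0 0 i)|
   + 34 * c * expR (z x) ^- 2.
Proof.
move=> Ox Op Om_ hh eps0 al0 hmin hlt.
have [Oh Oh' D0 De] := second_diff_bounds Ox Op Om_ hh.
set xp := h *: e + x in Oh D0 De *; set xm := - h *: e + x in Oh' D0 De *.
pose E := expR (- alpha * sqdist x0 x).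
have E0 : 0 < E by exact: expR_gt0.
pose d i := x 0 i - x0 0 i.
have key i : 2 * partial i z x - partial i z xp - partial i z xm =
      eps * (- (2 * alpha * d i * E)) /\
    eps * ((4 * alpha ^+ 2 * d i ^+ 2 - 2 * alpha) * E) <=
    2 * partial i (partial i z) x - partial i (partial i z) xp - partial i (partial i z) xm.
  pose ei : 'rV[R]_n := delta_mx 0 i.
  have J := jet2B (jet2B (jet2B (jet2Z 2 (jet2_coord oOm zC2 ei Ox))
     (jet2_coord oOm zC2 ei Oh)) (jet2_coord oOm zC2 ei Oh'))
     (jet2Z eps (jet2_barrier x0 alpha rr x i)).
  have [] := jet2_min _ J.
    apply: filterS (@near_line _ _ _ _ ei hmin) => t.
    rewrite !scale0r !add0r /second_diff -/xp -/xm.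
    by rewrite ![_ *: e + (t *: ei + x)]addrCA -/xp -/xm.
  rewrite !grad_dir_delta !hess_form_delta -/(d i) -/E => h1' h2'.
  split; first by apply/eqP; rewrite -subr_eq0 h1'.
  by rewrite -subr_ge0.
(* second order condition, summed over the coordinates *)
have hL : eps * ((4 * alpha ^+ 2 * sqdist x0 x - 2 * alpha * n%:R) * E) <=
    2 * laplacian z x - laplacian z xp - laplacian z xm.
  rewrite /laplacian [2 * \sum_(i < n) _]mulr_sumr -!sumrB.
  have -> : eps * ((4 * alpha ^+ 2 * sqdist x0 x - 2 * alpha * n%:R) * E) =
    \sum_(i < n) eps * ((4 * alpha ^+ 2 * d i ^+ 2 - 2 * alpha) * E).
    rewrite -mulr_sumr -mulr_suml sumrB -mulr_sumr sumr_const card_ord.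
    by rewrite -/(sqdist x0 x) -(mulr_natr (2 * alpha) n).
  by apply: ler_sum => i _; case: (key i).
pose B := \sum_(i < n) partial i z x * d i.
(* second difference of the squared gradient, by its convexity *)
have hS : 2 * sqgrad z x - sqgrad z xp - sqgrad z xm <=
    eps * (4 * alpha * `|B| * E).
  apply: (@le_trans _ _ (\sum_(i < n) 2 * partial i z x * (eps * (- (2 * alpha * d i * E))))).
    rewrite /sqgrad mulr_sumr -!sumrB; apply: ler_sum => i _.
    by case: (key i) => <- _; exact: sqr_second_difference.
  have -> : \sum_(i < n) 2 * partial i z x * (eps * (- (2 * alpha * d i * E)))
     = eps * (4 * alpha * (- B) * E).
    rewrite /B -sumrN mulr_sumr mulr_suml mulr_sumr; apply: eq_bigr => i _.
    by ring.
  rewrite ler_pM2l // ler_pM2r // ler_pM2l ?mulr_gt0 //.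
  by rewrite (le_trans (ler_norm _)) // normrN.
have hexp : expR (z xp) ^- 2 + expR (z xm) ^- 2 - 2 * expR (z x) ^- 2 <=
    expR (z x) ^- 2 * (34 * second_diff e h x).
  have : expR (z x) ^- 2 * (expR (z xp - z x) ^- 2 + expR (z xm - z x) ^- 2 - 2)
     <= expR (z x) ^- 2 * (34 * second_diff e h x).
    by rewrite ler_pM2l // invr_gt0 exprn_gt0 // expR_gt0.
  rewrite !expRB.
  have X0 := expR_gt0 (z x); have P0 := expR_gt0 (z xp); have M0 := expR_gt0 (z xm).
  apply: le_trans; rewrite le_eqVlt; apply/orP; left; apply/eqP.
  by field; rewrite !gt_eqF.
have hD : second_diff e h x <= eps * E.
  apply: le_trans (ltW hlt) _; rewrite ler_pM2l // /barrier /E lerBlDr lerDl.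
  exact: expR_ge0.
rewrite !zpde // in hL.
have Y0 : 0 < expR (z x) ^- 2 by rewrite invr_gt0 exprn_gt0 // expR_gt0.
have hexp2 : expR (z xp) ^- 2 + expR (z xm) ^- 2 - 2 * expR (z x) ^- 2 <=
    expR (z x) ^- 2 * (34 * (eps * E)).
  by apply: le_trans hexp _; rewrite ler_pM2l // ler_pM2l.
have c1' : 0 <= c - 1 by rewrite subr_ge0.
have hS2 := ler_wpM2l c1' hS.
have hexp3 := ler_wpM2l (ltW c0) hexp2.
rewrite -(ler_pM2r (mulr_gt0 eps0 E0)).
exact: touching_algebra hL hS2 hexp3.
Qed.

Lemma continuous_second_diff e h y : Om y -> Om (h *: e + y) -> Om (- h *: e + y) ->
  {for y, continuous (second_diff e h)}.
Proof.
move=> Oy Op Om_.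
have cz x : Om x -> {for x, continuous z} by move=> /zC2[].
have ct k : Om (k *: e + y) -> z (k *: e + w) @[w --> y] --> z (k *: e + y).
  by move=> O'; apply: (@continuous_at_translate R _ z (k *: e) y); exact: cz.
apply: continuous_at_sub; last exact: ct.
apply: continuous_at_sub; last exact: ct.
by apply: continuous_at_mul; [exact: continuous_at_cst|exact: cz].
Qed.

(** The bound is quadratic in [h] with a constant that does not depend on [h], so it
survives in the limit as a bound on the second derivative. *)
Definition unif_lower e x (rho : R) := exists m h0 : R,
  [/\ 0 < m, 0 < h0 & forall h y, 0 < h < h0 -> `|y - x| <= rho ->
     m * h ^+ 2 <= second_diff e h y].

(** The barrier, scaled by [m h^2], lies below the second difference near the centre
by hypothesis and on the outer sphere because it vanishes there;
[touching_inequality] excludes a negative interior minimum of the difference. The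
exponent depends only on bounds for [z] and its gradient on the larger ball, not
on [h]. The division by [n] fits a ball of the maximum norm into a Euclidean
ball. *)
Lemma unif_lower_spread e x (rho delta : R) : 0 < rho -> 0 < delta ->
  (forall y, `|y - x| <= 2 * delta -> Om y) ->
  unif_lower e x rho -> unif_lower e x (delta / 2 / n%:R).
Proof.
move=> rho0 del0 ball [m [h0 [m0 h00 hm]]].
pose h1 := delta / (`|e| + 1).
have e1 : 0 < `|e| + 1 by rewrite ltr_wpDl.
have h10 : 0 < h1 by rewrite divr_gt0.
pose K := [set y : 'rV[R]_n | sqdist x y <= delta ^+ 2].
have cK : compact K by apply: compact_sqball; exact: ltW.
have room y t : K y -> `|t| <= h1 -> Om (t *: e + y).
  move=> Ky th; apply: ball; rewrite -addrA (le_trans (ler_normD _ _)) // normrZ.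
  rewrite mulr_natl mulr2n lerD //; last exact: sqdist_norm (ltW del0) Ky.
  apply: (@le_trans _ _ (h1 * (`|e| + 1))); last by rewrite divfK // gt_eqF.
  by rewrite ler_pM // lerDl.
have KO y : K y -> Om y.
  by move=> Ky; have := room y 0 Ky; rewrite normr0 scale0r add0r; apply; rewrite ?ltW.
have [B B0 hB] : exists2 B, 0 <= B & forall y, K y ->
    `|\sum_(i < n) partial i z y * (y 0 i - x 0 i)| <= B.
  apply: compact_upper_bound => // y Ky.
  have [_ _ d1 _ _] := zC2 (KO _ Ky).
  apply: continuous_at_comp; last exact: norm_continuous.
  apply: continuous_sum_at => i; apply: continuous_at_mul; first exact: d1.
  by apply: continuous_at_sub; [exact: coord_continuous|exact: continuous_at_cst].
have [Eb E0 hE] : exists2 Eb, 0 <= Eb & forall y, K y -> expR (z y) ^- 2 <= Eb.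
  apply: compact_upper_bound => // y Ky; have [cz _ _ _ _] := zC2 (KO _ Ky).
  apply: (@continuous_at_comp _ _ _ (fun r : R => expR r ^- 2)); first exact: cz.
  apply: cvgV; first by rewrite expf_neq0 // gt_eqF // expR_gt0.
  apply: (@continuous_at_comp _ _ _ (fun r : R => r ^+ 2)).
    exact: continuous_expR.
  exact: exprn_continuous.
pose C := 2 * n%:R + 4 * (c - 1) * B + 34 * c * Eb.
have C0 : 0 <= C.
  by rewrite /C !addr_ge0 // !mulr_ge0 // ?subr_ge0 // ltW.
(* chosen so that [C < 4 * rho ^+ 2 * alpha], as [barrier_dominates] requires *)
pose alpha := 1 + C / (4 * rho ^+ 2).
have al1 : 1 <= alpha by rewrite lerDl divr_ge0 // mulr_ge0 // sqr_ge0.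
have al0 : 0 < alpha by exact: lt_le_trans al1.
pose w := expR (- alpha * (delta / 2) ^+ 2) - expR (- alpha * delta ^+ 2).
have w0 : 0 < w.
  rewrite subr_gt0 ltr_expR !mulNr ltrN2 ltr_pM2l // ltr_pXn2r ?nnegrE //.
  - by rewrite ltr_pdivrMr // ltr_pMr // ltr1n.
  - by rewrite divr_ge0 // ltW.
  - exact: ltW.
exists (m * w), (Num.min h0 (h1 / 5)); split.
- exact: mulr_gt0.
- by rewrite lt_min h00 divr_gt0.
move=> h y /andP[hpos]; rewrite lt_min => /andP[hh0 hh1] ynear.
have hr : 0 < h <= h1 / 5 by rewrite hpos ltW.
have qy : sqdist x y <= (delta / 2) ^+ 2 by exact: norm_sqdist.
have Ky : K y.
  apply: le_trans qy _; rewrite ler_pXn2r ?nnegrE ?divr_ge0 ?ltW //.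
  by rewrite ltr_pdivrMr // ltr_pMr // ltr1n.
pose eps := m * h ^+ 2.
have eps0 : 0 < eps by rewrite mulr_gt0 // exprn_gt0.
pose F v := second_diff e h v - eps * barrier x alpha delta v.
have hle : h <= h1 by rewrite (le_trans (ltW hh1)) // ler_pdivrMr // ler_pMr // ler1n.
have rooms v : K v -> [/\ Om v, Om (h1 *: e + v), Om (- h1 *: e + v),
     Om (h *: e + v) & Om (- h *: e + v)].
  move=> Kv; split; first exact: KO.
  - by apply: room => //; rewrite gtr0_norm.
  - by apply: room => //; rewrite normrN gtr0_norm.
  - by apply: room => //; rewrite gtr0_norm.
  - by apply: room => //; rewrite normrN gtr0_norm.
have [|//||k] := @EVT_min_rV R n F K.
- by exists y.
- rewrite continuous_subspace_in => v; rewrite inE => Kv.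
  apply: continuous_subspaceT_for => //; have [in1 _ _ in2 in3] := rooms _ Kv.
  apply: continuous_at_sub; first exact: continuous_second_diff.
  by apply: continuous_at_mul; [exact: continuous_at_cst|exact: continuous_barrier].
rewrite inE => Kk mink.
suff Fk : 0 <= F k.
  have : 0 <= F y by apply: le_trans Fk _; apply: mink; rewrite inE.
  rewrite subr_ge0; apply: le_trans.
  rewrite /eps mulrAC ler_pM2l ?mulr_gt0 ?exprn_gt0 // /w /barrier lerD2r ler_expR.
  by rewrite !mulNr lerN2 ler_pM2l.
rewrite leNgt; apply/negP => Fneg.
have [in1 in2 in3 _ _] := rooms _ Kk.
have [qd|qd] := eqVneq (sqdist x k) (delta ^+ 2).
  move: Fneg; rewrite /F /barrier qd subrr mulr0 subr0.
  have [_ _ h2 _] := second_diff_bounds in1 in2 in3 hr.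
  rewrite ltNge => /negP; apply; apply: le_trans h2.
  by rewrite divr_ge0 // addr_ge0 // sqr_ge0.
have qlt : sqdist x k < delta ^+ 2 by rewrite lt_neqAle qd.
have [qr|qr] := lerP (sqdist x k) (rho ^+ 2).
  have knear := sqdist_norm (ltW rho0) qr.
  have h3 : 0 < h < h0 by rewrite hpos.
  have := hm h k h3 knear.
  rewrite -/eps => h4.
  have : eps * barrier x alpha delta k <= eps.
    rewrite ler_piMr // ?(ltW eps0) // /barrier.
    apply: (@le_trans _ _ (expR (- alpha * sqdist x k))).
      by rewrite lerBlDr lerDl expR_ge0.
    by rewrite expR_le1 mulNr oppr_le0 mulr_ge0 ?sqdist_ge0 // ltW.
  by move: Fneg; rewrite /F; lra.
have TI := @touching_inequality e k x h h1 eps alpha delta in1 in2 in3 hr eps0 al0.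
have nearK : \forall v \near k, K v.
  have : \forall v \near k, sqdist x v < delta ^+ 2.
    have := @continuous_sqdist R n x k; move/cvgr_lt; exact.
  by apply: filterS => v /ltW.
have lmin : \forall v \near k, F k <= F v.
  by apply: filterS nearK => v Kv; apply: mink; rewrite inE.
have {}TI := TI lmin; rewrite -subr_lt0 in TI; have {TI} := TI Fneg.
apply/negP; rewrite -ltNge.
have hBk := hB _ Kk; have hEk := hE _ Kk.
have alC : C < 4 * rho ^+ 2 * alpha.
  rewrite /alpha mulrDr mulr1 [_ * (C / _)]mulrC divfK; last first.
    by rewrite gt_eqF // mulr_gt0 // exprn_gt0.
  by rewrite ltrDr mulr_gt0 // exprn_gt0.
exact: barrier_dominates alC qr.
Qed.

Lemma continuous_grad_dir e x : Om x -> {for x, continuous (fun y => grad_dir z y e)}.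
Proof.
move=> /zC2[_ _ d1 _ _]; apply: continuous_sum_at => i.
by apply: continuous_at_mul; [exact: continuous_at_cst|exact: d1].
Qed.

(** Concavity of [exp z] bounds the second difference below by the squared
increments of [z], which are of order [h] where the derivative along [e] does not
vanish. *)
Lemma unif_lower_start e x : Om x -> grad_dir z x e != 0 ->
  exists2 rho, 0 < rho & unif_lower e x rho.
Proof.
move=> Ox gx; pose g := `|grad_dir z x e| / 2.
have g0 : 0 < g by rewrite divr_gt0 // normr_gt0.
have [d d0 hd] : exists2 d : R, 0 < d & forall v, `|v| < d ->
    Om (v + x) /\ g < `|grad_dir z (v + x) e|.
  apply: (@near_norm_ball _ _ (fun y => Om y /\ g < `|grad_dir z y e|)).
  apply: filterI; first exact: open_nbhs_nbhs.
  have cn : {for x, continuous (fun y => `|grad_dir z y e|)}.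
    apply: (@continuous_at_comp _ _ _ (fun r : R => `|r|)); last exact: norm_continuous.
    exact: continuous_grad_dir.
  by apply: (cvgr_gt _ cn); rewrite /g ltr_pdivrMr // ltr_pMr ?normr_gt0 // ltr1n.
pose h1 := d / 3 / (`|e| + 1).
have e1 : 0 < `|e| + 1 by rewrite ltr_wpDl.
have h10 : 0 < h1 by rewrite !divr_gt0.
have room y t : `|y - x| <= d / 3 -> `|t| <= h1 ->
    Om (t *: e + y) /\ g < `|grad_dir z (t *: e + y) e|.
  move=> yx th; rewrite -[y](subrK x) addrA; apply: hd.
  have te : `|t *: e| <= d / 3.
    rewrite normrZ; apply: (@le_trans _ _ (h1 * (`|e| + 1))); last by rewrite divfK // gt_eqF.
    by rewrite ler_pM // lerDl.
  by apply: le_lt_trans (ler_normD _ _) _; lra.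
exists (d / 3); first by rewrite divr_gt0.
exists (g ^+ 2 / 4), (h1 / 5); split.
- by rewrite divr_gt0 // exprn_gt0.
- by rewrite divr_gt0.
move=> h y /andP[h0 hh] yx.
have h1n : `|h1| <= h1 by rewrite gtr0_norm.
have h1n' : `|- h1| <= h1 by rewrite normrN gtr0_norm.
have Oy : Om y by have [] := room y 0 yx; rewrite ?normr0 ?(ltW h10) // scale0r add0r.
have hr : 0 < h <= h1 / 5 by rewrite h0 ltW.
have [_ _ lower _] := second_diff_bounds Oy (room y _ yx h1n).1 (room y _ yx h1n').1 hr.
apply: le_trans lower.
rewrite mulrAC ler_pM2r ?invr_gt0 // ler_wpDr ?sqr_ge0 //.
have hle : `|h| <= h1 by rewrite gtr0_norm // (le_trans (ltW hh)) // ler_pdivrMr // ler_pMr // ler1n.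
have [|s sh E] := @MVT_symmetric R (fun s : R => z (s *: e + y))
  (fun s : R => grad_dir z (s *: e + y) e) h.
  move=> s sh; apply: is_derive_line.
  exact: C2_is_derive oOm zC2 (room y s yx (le_trans sh hle)).1.
rewrite scale0r add0r in E; rewrite E [X in _ <= X]exprMn ler_pM2r ?exprn_gt0 //.
rewrite -[X in _ <= X]real_normK ?num_real // ler_pXn2r ?nnegrE ?(ltW g0) //.
by apply/ltW; exact: (room y s yx (le_trans sh hle)).2.
Qed.

Lemma unif_lowerS e x y (rho rho' : R) : (forall w, `|w - y| <= rho' -> `|w - x| <= rho) ->
  unif_lower e x rho -> unif_lower e y rho'.
Proof.
move=> sub [m [h0 [m0 h00 hm]]]; exists m, h0; split => // h w hh wy.
by apply: hm => //; exact: sub.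
Qed.

(** By convexity, balls of one radius around all points of the segment from [y] to
[x] lie in the domain, and finitely many applications of [unif_lower_spread] lead
from one end to the other. *)
Lemma unif_lower_chain e x y (rho : R) : Om x -> Om y -> 0 < rho ->
  unif_lower e y rho -> exists2 rho', 0 < rho' & unif_lower e x rho'.
Proof.
move=> Ox Oy rho0 Hy.
have [dx dx0 hdx] := @near_norm_ball R _ Om x (open_nbhs_nbhs (conj oOm Ox)).
have [dy dy0 hdy] := @near_norm_ball R _ Om y (open_nbhs_nbhs (conj oOm Oy)).
pose delta := Num.min dx dy / 3.
have m0 : 0 < Num.min dx dy by rewrite lt_min dx0 dy0.
have del0 : 0 < delta by rewrite divr_gt0.
have del2 v : `|v| <= 2 * delta -> Om (v + x) /\ Om (v + y).
  move=> vd; have : `|v| < Num.min dx dy by apply: le_lt_trans vd _; rewrite /delta; lra.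
  by rewrite lt_min => /andP[? ?]; split; [exact: hdx|exact: hdy].
have nR : (0 : R) < n%:R by rewrite ltr0n.
pose step := delta / 2 / n%:R / 2.
have step0 : 0 < step by rewrite !divr_gt0.
pose N := (Num.truncn (`|x - y| / step)).+1.
have N0 : (0 : R) < N%:R by rewrite ltr0n.
have hN : `|x - y| / N%:R <= step.
  rewrite ler_pdivrMr // mulrC -ler_pdivrMr //; apply: ltW.
  by rewrite truncnS_gt.
pose p (k : nat) : 'rV[R]_n := (k%:R / N%:R) *: (x - y) + y.
have pball k : (k <= N)%N -> forall w, `|w - p k| <= 2 * delta -> Om w.
  move=> kN w wk; have [wx wy] := del2 _ wk.
  have l01 : 0 <= (k%:R / N%:R : R) <= 1.
    by rewrite divr_ge0 ?ler0n //= ler_pdivrMr // mul1r ler_nat.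
  have := cOm wx wy l01; congr Om.
  by apply/rowP => j; rewrite /p !mxE; ring.
have main k : (k <= N)%N -> unif_lower e (p k) (delta / 2 / n%:R).
  elim: k => [_|k IH kN].
    apply: (@unif_lower_spread e (p 0%N) rho) => //; first exact: pball.
    by rewrite /p mul0r scale0r add0r.
  apply: (@unif_lower_spread e (p k.+1) step) => //; first exact: pball.
  apply: unif_lowerS (IH (ltnW kN)) => w wk.
  have E : p k.+1 - p k = N%:R^-1 *: (x - y).
    by apply/rowP => j; rewrite /p !mxE -natr1; ring.
  have Ek : `|p k.+1 - p k| <= step.
    by rewrite E normrZ normfV gtr0_norm // mulrC.
  rewrite -[w](subrK (p k.+1)) -addrA.
  apply: le_trans (ler_normD _ _) _.
  by apply: le_trans (lerD wk Ek) _; rewrite /step -splitr.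
exists (delta / 2 / n%:R); first by rewrite !divr_gt0.
have := main N (leqnn N).
by rewrite /p divff ?gt_eqF // scale1r subrK.
Qed.

(** Otherwise [z] is constant on the part of the line inside the domain. But
[exp z], extended by zero, is continuous and vanishes far away on the line, so it
takes half of its value at [x] at some point of that part. *)
Lemma line_nonconstant e x : Om x -> e != 0 ->
  exists2 t : R, Om (t *: e + x) & grad_dir z (t *: e + x) e != 0.
Proof.
move=> Ox e0; apply: contrapT => hno.
have flat t : Om (t *: e + x) -> grad_dir z (t *: e + x) e = 0.
  by move=> Ot; apply: contrapT => /eqP gt; apply: hno; exists t.
have [M [_ hM]] := bOm.
pose T := (`|M| + 2 + `|x|) / `|e|.
have en : 0 < `|e| by rewrite normr_gt0.
have T0 : 0 < T by rewrite divr_gt0 // addr_gt0 // ltr_wpDl.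
have out : ~ Om (T *: e + x).
  have ltM : M < `|M| + 1 by rewrite (le_lt_trans (ler_norm M)) // ltrDl.
  move=> /(hM _ ltM) /= le1.
  have le2 := ler_normD (T *: e + x) (- x).
  have Te : T * `|e| = `|M| + 2 + `|x| by rewrite divfK // gt_eqF.
  by rewrite addrK normrZ gtr0_norm // normrN Te in le2; lra.
pose V := exp_on Om z.
have cl : continuous (fun t : R => V (t *: e + x)).
  apply: (@continuous_comp_fun _ _ _ (fun t : R => t *: e + x) V) => // t.
  by apply: cvgD; [apply: cvgZ; [exact: cvg_id|exact: cvg_cst]|exact: cvg_cst].
have [||t] := @IVT R (fun t => V (t *: e + x)) 0 T (V x / 2) (ltW T0).
- exact: continuous_subspaceT.
- have VT : V (T *: e + x) = 0 by exact: exp_on_out.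
  rewrite scale0r add0r VT.
  have V0 : 0 < V x by exact: exp_on_gt0.
  by rewrite min_r ?(ltW V0) // max_l ?(ltW V0) //; lra.
rewrite in_itv /= => /andP[t0 tT] Vt.
have Vx : 0 < V x by exact: exp_on_gt0.
have Ot : Om (t *: e + x).
  by apply: (@exp_on_gt0_in _ _ Om z); rewrite -/V Vt divr_gt0.
have tpos : 0 < t.
  rewrite lt_neqAle t0 andbT; apply/eqP => tz; move: Vt; rewrite -tz scale0r add0r; lra.
have Os s : `|s| <= `|t| -> 0 <= s -> Om (s *: e + x).
  rewrite (gtr0_norm tpos) => st s0; rewrite ger0_norm // in st.
  have l01 : 0 <= s / t <= 1 by rewrite divr_ge0 //= ler_pdivrMr // mul1r.
  have := cOm Ot Ox l01; congr Om.
  by apply/rowP => j; rewrite !mxE; field; rewrite gt_eqF.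
have [|||s sin E] := @MVT R (fun s : R => z (s *: e + x)) (fun s => grad_dir z (s *: e + x) e) 0 t.
- exact: tpos.
- move=> s; rewrite in_itv /= => /andP[s0 st]; apply: is_derive_line.
  apply: C2_is_derive oOm zC2 (Os _ _ (ltW s0)).
  by rewrite !gtr0_norm // ltW.
- apply: derivable_within_continuous => s; rewrite in_itv /= => /andP[s0 st].
  have Oss : Om (s *: e + x) by apply: Os => //; rewrite !ger0_norm.
  by have [] := is_derive_line (@C2_is_derive _ _ Om z (s *: e + x) e oOm zC2 Oss).
move: sin; rewrite in_itv /= => /andP[s0 st].
have Oss : Om (s *: e + x) by apply: Os; rewrite ?(ltW s0) // !gtr0_norm // ltW.
move: E; rewrite flat // mul0r scale0r add0r => /subr0_eq zt.
move: Vt; rewrite /V !exp_onE // zt.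
by have := expR_gt0 (z x); lra.
Qed.

Lemma log_strictly_concave e x : Om x -> e != 0 -> hess_form z x e e < 0.
Proof.
move=> Ox e0.
have [t Ot gt] := line_nonconstant Ox e0.
have [rho rho0 Ht] := unif_lower_start Ot gt.
have [rho' rho'0 [m [h0 [m0 h00 hm]]]] := unif_lower_chain Ox Ot rho0 Ht.
have J1 := jet2_coord oOm zC2 e Ox.
(* [- z (x + t e) - z (x - t e) - m t^2] has a minimum at [t = 0] *)
have J3 := jet2Z m (jet2_quadratic 0 0).
have J4 := jet2B (jet2N (jet2D J1 (jet2_scale (-1) J1))) J3.
have [] := jet2_min _ J4; last first.
  by move=> _; rewrite sqrrN expr1n mul1r; lra.
have : \forall t \near (0 : R), `|t| < h0.
  by apply/nbhs_ballP; exists h0 => //= s; rewrite /ball /= sub0r normrN.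
apply: filterS => s sh.
rewrite !mulr0 !scale0r !add0r expr0n /= mulr0 subr0 mulN1r.
have hm' h : 0 < h < h0 -> m * h ^+ 2 <= second_diff e h x.
  by move=> hh; apply: hm => //; rewrite subrr normr0 ltW.
have [s0|s0|->] := ltrgtP s 0.
- have := hm' (- s); rewrite oppr_gt0 s0 /= => /(_ _).
  rewrite ltr0_norm // in sh; move=> /(_ sh).
  by rewrite /second_diff opprK sqrrN; lra.
- rewrite gtr0_norm // in sh.
  by have := hm' s; rewrite s0 sh => /(_ isT); rewrite /second_diff; lra.
- by rewrite expr0n /= mulr0 subr0 oppr0 scale0r add0r.
Qed.

Lemma exp_on_hess_le0 e x : Om x ->
  hess_form z x e e + grad_dir z x e ^+ 2 <= 0.
Proof.
move=> Ox.
have J1 := jet2_exp oOm zC2 e Ox.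
have J := jet2N (jet2D J1 (jet2_scale (-1) J1)).
have V0 := exp_on_gt0 z Ox.
have [] := jet2_min _ J; last first.
  move=> _; rewrite sqrrN expr1n mul1r => h.
  by rewrite -(pmulr_rle0 _ V0); lra.
have nO : \forall y \near x, Om y by exact: open_nbhs_nbhs.
apply: filterS2 (@near_line _ _ _ _ e nO) (@near_line _ _ _ _ (- e) nO) => s s1 s2.
rewrite mulr0 !scale0r add0r mulN1r.
have half : 0 < (1 / 2 : R) < 1 by lra.
have N : - s *: e = s *: - e by rewrite scaleNr scalerN.
have := V_concave s1 s2 half; rewrite N.
have -> : (1 / 2) *: (s *: e + x) + (1 - 1 / 2) *: (s *: - e + x) = x.
  by apply/rowP => j; rewrite !mxE; field.
by lra.
Qed.

End Strict.

(** * Curvature of a conformally flat metric *)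

Section ConformalCurvature.
Context {R : realType} {n : nat}.
Variables (Om : set 'rV[R]_n) (z : 'rV[R]_n -> R) (g : 'rV[R]_n -> 'M[R]_n).
Hypothesis oOm : open Om.
Hypothesis zC2 : C2_on Om z.
Hypothesis gE : forall x, Om x -> g x = expR (- 2 * z x) *: 1%:M.

Local Notation D i j := ((i == j)%:R : R).

Lemma sum_delta_l (F : 'I_n -> R) j : \sum_(i < n) D j i * F i = F j.
Proof.
rewrite (bigD1 j) //= eqxx mul1r big1 ?addr0 // => i ij.
by rewrite eq_sym (negbTE ij) mul0r.
Qed.

Lemma delta_sym (i j : 'I_n) : D i j = D j i. Proof. by rewrite eq_sym. Qed.

Lemma partial_conformal x l i j : Om x ->
  partial l (fun y => g y i j) x = - 2 * expR (- 2 * z x) * D i j * partial l z x.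
Proof.
move=> Ox.
have nO : \forall y \near x, Om y by exact: open_nbhs_nbhs.
rewrite (@partial_near _ _ _ (fun y => (fun r => expR (- 2 * r) * D i j) (z y))); last first.
  by apply: filterS nO => y Oy; rewrite gE // !mxE.
apply: (@partial_comp R n z (fun r => expR (- 2 * r) * D i j)).
  by have [_ d1 _ _ _] := zC2 Ox; exact: d1.
have h1 := is_derive_mull (- 2) (z x).
have h2 := is_derive_comp1 h1 (is_derive_expR _).
have h3 : is_derive (expR (- 2 * z x)) 1 (fun r : R => r * D i j) (D i j).
  have -> : (fun r : R => r * D i j) = (fun r : R => D i j * r).
    by apply/funext => r; rewrite mulrC.
  exact: is_derive_mull.
apply: (is_derive_eq (is_derive_comp1 h2 h3)); ring.
Qed.

Lemma christoffel_conformal k i j x : Om x ->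
  christoffel g k i j x =
  - (D k j * partial i z x + D k i * partial j z x - D i j * partial k z x).
Proof.
move=> Ox; rewrite /christoffel gE // scalemx1 invmx_scalar.
have E0 : expR (- 2 * z x) != 0 by rewrite gt_eqF // expR_gt0.
under eq_bigr => l _.
  rewrite !partial_conformal // mxE -[_ *+ _]mulr_natl -mulrA.
  over.
rewrite sum_delta_l [D j k]delta_sym [D i k]delta_sym.
by field.
Qed.

Lemma partial_christoffel m k i j x : Om x ->
  partial m (christoffel g k i j) x =
  - (D k j * partial m (partial i z) x + D k i * partial m (partial j z) x
     - D i j * partial m (partial k z) x).
Proof.
move=> Ox.
have nO : \forall y \near x, Om y by exact: open_nbhs_nbhs.
rewrite (@partial_near _ _ _ (fun y => - (D k j * partial i z y + D k i * partial j z y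
     - D i j * partial k z y))); last first.
  by apply: filterS nO => y Oy; rewrite christoffel_conformal.
have [_ _ _ d2 _] := zC2 Ox.
have dz l : is_derive x (delta_mx 0 m) (partial l z) (partial m (partial l z) x).
  exact: derivableP (d2 l m).
have := is_deriveN (is_deriveB (is_deriveD (is_deriveZ (D k j) (dz i)) (is_deriveZ (D k i) (dz j)))
   (is_deriveZ (D i j) (dz k))).
by case.
Qed.

(** Minus the Schouten tensor of the metric [e^(-2z) I]. As the Weyl tensor of a
conformally flat metric vanishes, it determines the curvature. *)
Definition neg_schouten x (a b : 'I_n) : R :=
  - partial b (partial a z) x - partial a z x * partial b z x
  + sqgrad z x / 2 * D a b.

Lemma neg_schouten_sym x a b : Om x -> neg_schouten x a b = neg_schouten x b a.
Proof.
move=> Ox; rewrite /neg_schouten (partial_sym a b oOm zC2 Ox) (delta_sym a b).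
by rewrite [partial a z x * _]mulrC.
Qed.

Lemma christoffel_product l i j k x : Om x ->
  \sum_(m < n) christoffel g m j k x * christoffel g l i m x =
  partial j z x * (D l k * partial i z x + D l i * partial k z x - D i k * partial l z x)
  + partial k z x * (D l j * partial i z x + D l i * partial j z x - D i j * partial l z x)
  - D j k * (D l i * sqgrad z x).
Proof.
move=> Ox; pose p a := partial a z x; rewrite -/(p i) -/(p j) -/(p k) -/(p l).
pose G m := D l m * p i + D l i * p m - D i m * p l.
transitivity (\sum_(m < n) (D k m * (p j * G m) + D j m * (p k * G m) - D j k * (p m * G m))).
  apply: eq_bigr => m _; rewrite !christoffel_conformal // (delta_sym m k) (delta_sym m j) /G /p.
  move: (partial i z x) (partial j z x) (partial k z x) (partial l z x) (partial m z x)
    (D k m) (D j m) (D j k) (D l m) (D l i) (D i m)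
    => p1 p2 p3 p4 p5 d1 d2 d3 d4 d5 d6.
  by ring.
rewrite sumrB big_split /= !sum_delta_l -mulr_sumr.
have -> : \sum_(m < n) p m * G m = D l i * sqgrad z x.
  transitivity (\sum_(m < n) (D l m * (p m * p i) + D l i * (p m ^+ 2) - D i m * (p m * p l))).
    apply: eq_bigr => m _; rewrite /G.
    by move: (p m) (p i) (p l) (D l m) (D l i) (D i m) => p1 p2 p3 d1 d2 d3; ring.
  rewrite sumrB big_split /= !sum_delta_l -mulr_sumr /sqgrad -/p.
  by ring.
by rewrite /G.
Qed.

Lemma riemann_conformal l i j k x : Om x ->
  riemann g l i j k x =
  D l j * neg_schouten x k i - D l i * neg_schouten x k j
  - D j k * neg_schouten x l i + D i k * neg_schouten x l j.
Proof.
move=> Ox; rewrite /riemann sumrB !christoffel_product // !partial_christoffel //.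
rewrite /neg_schouten (partial_sym k i oOm zC2 Ox) (partial_sym k j oOm zC2 Ox)
  (partial_sym l i oOm zC2 Ox) (partial_sym l j oOm zC2 Ox) (partial_sym j i oOm zC2 Ox).
rewrite (delta_sym k i) (delta_sym k j) (delta_sym l k) (delta_sym j i) /=.
move: (partial i z x) (partial j z x) (partial k z x) (partial l z x) (sqgrad z x)
  (partial j (partial i z) x) (partial k (partial i z) x) (partial l (partial i z) x)
  (partial k (partial j z) x) (partial l (partial j z) x)
  (D k l) (D l j) (D j k) (D l i) (D i k) (D i j)
  => p1 p2 p3 p4 S p5 p6 p7 p8 p9 d1 d2 d3 d4 d5 d6.
by field.
Qed.

Definition dot (X Y : 'rV[R]_n) : R := \sum_(i < n) X 0 i * Y 0 i.

Definition neg_schouten_form x (X Y : 'rV[R]_n) : R :=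
  \sum_(i < n) X 0 i * \sum_(j < n) Y 0 j * neg_schouten x i j.

Lemma curv_conformal x X Y Z l : Om x ->
  curv g x X Y Z 0 l =
  Y 0 l * neg_schouten_form x X Z - X 0 l * neg_schouten_form x Y Z
  - dot Y Z * (\sum_(i < n) X 0 i * neg_schouten x l i)
  + dot X Z * (\sum_(j < n) Y 0 j * neg_schouten x l j).
Proof.
move=> Ox; rewrite mxE.
pose b i := \sum_(k < n) Z 0 k * neg_schouten x i k.
have step1 i j : \sum_(k < n) riemann g l i j k x * X 0 i * Y 0 j * Z 0 k =
    X 0 i * Y 0 j * (D l j * b i - D l i * b j - neg_schouten x l i * Z 0 j
       + neg_schouten x l j * Z 0 i).
  transitivity (X 0 i * Y 0 j * \sum_(k < n) (D l j * (Z 0 k * neg_schouten x i k)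
      - D l i * (Z 0 k * neg_schouten x j k)
      - D j k * (neg_schouten x l i * Z 0 k) + D i k * (neg_schouten x l j * Z 0 k))).
    rewrite mulr_sumr; apply: eq_bigr => k _; rewrite riemann_conformal //.
    rewrite (neg_schouten_sym k i Ox) (neg_schouten_sym k j Ox).
    by ring.
  by rewrite big_split /= !sumrB !sum_delta_l -!mulr_sumr.
have step2 i : \sum_(j < n) \sum_(k < n) riemann g l i j k x * X 0 i * Y 0 j * Z 0 k =
    X 0 i * (Y 0 l * b i - D l i * (\sum_(j < n) Y 0 j * b j) - neg_schouten x l i * dot Y Z
     + Z 0 i * (\sum_(j < n) Y 0 j * neg_schouten x l j)).
  transitivity (X 0 i * \sum_(j < n) (D l j * (Y 0 j * b i) - D l i * (Y 0 j * b j)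
     - neg_schouten x l i * (Y 0 j * Z 0 j) + Z 0 i * (Y 0 j * neg_schouten x l j))).
    by rewrite mulr_sumr; apply: eq_bigr => j _; rewrite step1; ring.
  by rewrite big_split /= !sumrB !sum_delta_l -!mulr_sumr.
transitivity (\sum_(i < n) (Y 0 l * (X 0 i * b i) - D l i * (X 0 i * \sum_(j < n) Y 0 j * b j)
   - dot Y Z * (X 0 i * neg_schouten x l i)
   + (\sum_(j < n) Y 0 j * neg_schouten x l j) * (X 0 i * Z 0 i))).
  by apply: eq_bigr => i _; rewrite step2; ring.
rewrite big_split /= !sumrB sum_delta_l -!mulr_sumr -/(dot X Z).
by rewrite /neg_schouten_form -/b [_ * dot X Z]mulrC.
Qed.

Lemma gdot_conformal x X Y : Om x -> gdot g x X Y = expR (- 2 * z x) * dot X Y.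
Proof.
move=> Ox; rewrite /gdot gE // -scalemxAr mulmx1 -scalemxAl mxE; congr (_ * _).
by rewrite mxE; apply: eq_bigr => i _; rewrite mxE.
Qed.

(** The bracket is the Kulkarni-Nomizu product of the Euclidean metric with
[neg_schouten], evaluated on the plane of [X] and [Y]. *)
Lemma sectional_numerator x X Y : Om x ->
  gdot g x (curv g x X Y Y) X = - expR (- 2 * z x) *
   (dot X X * neg_schouten_form x Y Y + dot Y Y * neg_schouten_form x X X
    - 2 * dot X Y * neg_schouten_form x X Y).
Proof.
move=> Ox; rewrite gdot_conformal // [RHS]mulNr -[RHS]mulrN; congr (_ * _).
transitivity (\sum_(l < n) (neg_schouten_form x X Y * (X 0 l * Y 0 l)
   - neg_schouten_form x Y Y * (X 0 l * X 0 l)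
   - dot Y Y * (X 0 l * (\sum_(i < n) X 0 i * neg_schouten x l i))
   + dot X Y * (X 0 l * (\sum_(j < n) Y 0 j * neg_schouten x l j)))).
  by apply: eq_bigr => l _; rewrite curv_conformal //; ring.
rewrite big_split /= !sumrB -!mulr_sumr -/(dot X Y) -/(dot X X).
rewrite -/(neg_schouten_form x X X) -/(neg_schouten_form x X Y).
by ring.
Qed.

Lemma ricci_conformal x X : Om x ->
  ricci g x X X = - ((n%:R - 2) * neg_schouten_form x X X)
    - dot X X * (\sum_(i < n) neg_schouten x i i).
Proof.
move=> Ox; rewrite /ricci.
have dl (i : 'I_n) (Y : 'rV[R]_n) : dot (delta_mx 0 i) Y = Y 0 i.
  rewrite /dot -[RHS]sum_delta_l; apply: eq_bigr => j _.
  by rewrite mxE eqxx /= eq_sym.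
have sl (i : 'I_n) (F : 'I_n -> R) : \sum_(j < n) delta_mx 0 i 0 j * F j = F i.
  rewrite -[RHS]sum_delta_l; apply: eq_bigr => j _.
  by rewrite mxE eqxx /= eq_sym.
transitivity (\sum_(i < n) (X 0 i * (\sum_(j < n) X 0 j * neg_schouten x i j)
   - neg_schouten_form x X X - dot X X * neg_schouten x i i
   + X 0 i * (\sum_(j < n) X 0 j * neg_schouten x i j))).
  apply: eq_bigr => i _; rewrite curv_conformal // dl {1}/neg_schouten_form !sl.
  by rewrite mxE !eqxx mul1r.
rewrite big_split /= !sumrB -/(neg_schouten_form x X X) -mulr_sumr sumr_const card_ord.
rewrite -[_ *+ n]mulr_natr; ring.
Qed.

Lemma neg_schouten_formE x X : neg_schouten_form x X X =
  - hess_form z x X X - grad_dir z x X ^+ 2 + sqgrad z x / 2 * dot X X.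
Proof.
transitivity (\sum_(i < n) (- (\sum_(j < n) X 0 i * X 0 j * partial j (partial i z) x)
   - X 0 i * partial i z x * grad_dir z x X + sqgrad z x / 2 * (X 0 i * X 0 i))).
  apply: eq_bigr => i _.
  transitivity (\sum_(j < n) (- (X 0 i * X 0 j * partial j (partial i z) x)
    - X 0 i * partial i z x * (X 0 j * partial j z x)
    + D i j * (sqgrad z x / 2 * X 0 i * X 0 j))).
    rewrite mulr_sumr; apply: eq_bigr => j _; rewrite /neg_schouten; ring.
  rewrite big_split /= sumrB sum_delta_l sumrN -mulr_sumr -/(grad_dir z x X).
  by rewrite mulrA.
rewrite big_split /= sumrB sumrN -mulr_suml -mulr_sumr -/(grad_dir z x X) -/(dot X X).
by rewrite expr2.
Qed.

Lemma trace_neg_schouten x : \sum_(i < n) neg_schouten x i i =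
  - laplacian z x - sqgrad z x + n%:R / 2 * sqgrad z x.
Proof.
rewrite /neg_schouten big_split /= sumrB sumrN; congr (_ + _); last first.
  under eq_bigr do rewrite eqxx mulr1.
  by rewrite sumr_const card_ord -[_ *+ n]mulr_natr; ring.
Qed.

End ConformalCurvature.

(** * The logarithmic form of the Loewner-Nirenberg problem *)

Section Reduction.
Context {R : realType} {n : nat}.
Implicit Types (Om : set 'rV[R]_n) (u : 'rV[R]_n -> R).

Lemma convex_set_segments Om : convex_set Om -> segment_convex Om.
Proof.
move=> h x y l Ox Oy /andP[l0 l1].
by have := h x y (Itv01 l0 l1) (mem_set Ox) (mem_set Oy); rewrite inE.
Qed.

(** Normalised so that the conformal factor [u^(4/(n-2))] equals [e^(-2z)]. *)
Definition log_solution u (x : 'rV[R]_n) : R := - (2 / (n%:R - 2)) * ln (u x).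

Variables (Om : set 'rV[R]_n) (u : 'rV[R]_n -> R).
Hypothesis hn : (3 <= n)%N.
Hypothesis oOm : open Om.
Hypothesis hu : loewner_nirenberg Om u.

Let z := log_solution u.
Let k : R := 2 / (n%:R - 2).

Let n2 : (0 : R) < n%:R - 2.
Proof. by rewrite subr_gt0 ltr_nat. Qed.

Let k0 : 0 < k. Proof. by rewrite divr_gt0. Qed.

Let u_gt0 x : Om x -> 0 < u x. Proof. by case: hu => _ + _ _; apply. Qed.

Let uC2 : C2_on Om u. Proof. by case: hu. Qed.

Let dg x : Om x -> is_derive (u x) 1 (fun r : R => - k * ln r) ((fun r => - k / r) (u x)).
Proof.
move=> Ox; have h1 := is_derive1_ln (u_gt0 Ox).
exact: (is_derive_eq (is_derive_comp1 h1 (is_derive_mull (- k) _))).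
Qed.

Let dg1 x : Om x -> is_derive (u x) 1 (fun r : R => - k / r) ((fun r => k / r ^+ 2) (u x)).
Proof.
move=> Ox; have ux : u x != 0 by rewrite gt_eqF // u_gt0.
have h1 : is_derive (u x) 1 (fun r : R => r^-1) (- (u x) ^- 2).
  by have := @is_deriveV _ id (u x) 1 1 ux (is_derive_id _ _); rewrite [_ *: 1]mulr1.
apply: (is_derive_eq (is_derive_comp1 h1 (is_derive_mull (- k) _))).
by rewrite mulrNN.
Qed.

Let cg2 x : Om x -> {for u x, continuous (fun r : R => k / r ^+ 2)}.
Proof.
move=> Ox; apply: continuous_quotient; first exact: cvg_cst.
  exact: exprn_continuous.
by rewrite expf_neq0 // gt_eqF // u_gt0.
Qed.

Lemma log_solution_C2 : C2_on Om z.
Proof. exact: (C2_on_comp oOm uC2 dg dg1 cg2). Qed.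

Lemma conformal_factor x : Om x ->
  u x `^ (4%:R / (n%:R - 2%:R)) = expR (- 2 * z x).
Proof.
move=> Ox; rewrite /powR gt_eqF ?u_gt0 // /z /log_solution; congr expR.
by field; rewrite gt_eqF.
Qed.

Lemma log_solution_pde x : Om x ->
  laplacian z x = (n%:R / 2 - 1) * sqgrad z x - n%:R / 2 * expR (z x) ^- 2.
Proof.
move=> Ox; have ux := u_gt0 Ox; have ux0 : u x != 0 by rewrite gt_eqF.
have [_ _ pde _] := hu.
have E2 : u x `^ ((n%:R + 2) / (n%:R - 2)) = u x * expR (z x) ^- 2.
  have -> : expR (z x) ^- 2 = u x `^ (4 / (n%:R - 2)).
    rewrite conformal_factor // -expRM_natl -expRN; congr expR; ring.
  have -> : (n%:R + 2) / (n%:R - 2) = 1 + 4 / (n%:R - 2) :> R.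
    by field; rewrite gt_eqF.
  by rewrite powRD ?ux0 ?implybT // powRr1 // ltW.
have Lu : \sum_(i < n) partial i (partial i u) x =
    4^-1 * n%:R * (n%:R - 2) * (u x * expR (z x) ^- 2).
  by rewrite -E2 -pde.
have S : sqgrad z x = k ^+ 2 * \sum_(i < n) (partial i u x / u x) ^+ 2.
  rewrite /sqgrad mulr_sumr; apply: eq_bigr => i _.
  rewrite (partial_compE uC2 dg i Ox).
  by field.
have L : laplacian z x = k * (\sum_(i < n) (partial i u x / u x) ^+ 2)
    - k / u x * \sum_(i < n) partial i (partial i u) x.
  rewrite /laplacian !mulr_sumr -sumrB; apply: eq_bigr => i _.
  rewrite (partial2_compE oOm uC2 dg dg1 i i Ox).
  by field.
rewrite L S Lu /k.
by field; rewrite ux0 !gt_eqF // expR_gt0.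
Qed.

(** Outside the domain the value is 0, and nearby values inside it are small
because [u] blows up at the boundary. *)
Lemma exp_log_solution_continuous : continuous (exp_on Om z).
Proof.
move=> x; have [Ox|Nx] := pselect (Om x).
  have nO : \forall y \near x, Om y by exact: open_nbhs_nbhs.
  have E : {near x, (fun y => expR (z y)) =1 exp_on Om z}.
    by apply: filterS nO => y Oy; rewrite exp_onE.
  rewrite /continuous_at exp_onE //; apply: cvg_trans (near_eq_cvg E) _.
  apply: (@continuous_at_comp _ _ _ (@expR R)); last exact: continuous_expR.
  by have [] := log_solution_C2 Ox.
apply: continuous_at_eps => e e0; rewrite (exp_on_out z Nx).
suff : \forall y \near within Om (nbhs x), expR (z y) < e.
  rewrite near_withinE; apply: filterS => y hy; rewrite subr0.
  have [Oy|Ny] := pselect (Om y); last by rewrite exp_on_out // normr0.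
  by rewrite exp_onE // ger0_norm ?expR_ge0 //; exact: hy.
have [cx|ncx] := pselect (closure Om x); last first.
  rewrite near_withinE.
  have : open (~` closure Om) by exact/closed_openC/closed_closure.
  move=> oc; have : \forall y \near x, (~` closure Om) y by exact: open_nbhs_nbhs.
  by apply: filterS => y ny Oy; case: ny; exact: subset_closure.
have [_ _ _ blow] := hu.
have /cvgryPgt /(_ (expR (- ln e / k))) := blow x (conj cx Nx).
rewrite !near_withinE; apply: filterS => y hy Oy.
have := hy Oy; rewrite -[X in _ < X]lnK ?posrE ?u_gt0 // ltr_expR => h.
rewrite -[X in _ < X]lnK ?posrE // ltr_expR /z /log_solution -/k.
by move: h; rewrite ltr_pdivrMr //; lra.
Qed.

End Reduction.

(** * Signs of the curvatures *)

Lemma dot_gt0 {R : realType} {n : nat} (X : 'rV[R]_n) : X != 0 -> 0 < dot X X.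
Proof.
move=> X0; rewrite lt_neqAle eq_sym; apply/andP; split; last first.
  by apply: sumr_ge0 => i _; rewrite -expr2 sqr_ge0.
apply: contraNneq X0 => X0; apply/eqP/rowP => i; rewrite mxE.
have nn (j : 'I_n) : true -> 0 <= X 0 j * X 0 j by move=> _; rewrite -expr2 sqr_ge0.
by apply/eqP; rewrite -sqrf_eq0 expr2 (psumr_eq0P nn X0).
Qed.

Section Planes.
Context {R : realType} {n : nat}.
Implicit Types (X Y Z : 'rV[R]_n).

Lemma row_free_col_mx_comb X Y (a b : R) : row_free (col_mx X Y) ->
  a *: X + b *: Y = 0 -> a = 0 /\ b = 0.
Proof.
move=> rf h.
have : row_mx (a%:M : 'M[R]_1) (b%:M : 'M[R]_1) *m col_mx X Y == 0.
  by rewrite mul_row_col !mul_scalar_mx h.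
rewrite mulmx_free_eq0 // => /eqP; rewrite -row_mx0 => /eq_row_mx[ha hb].
by split; [have := congr1 (fun A : 'M[R]_1 => A 0 0) ha|
  have := congr1 (fun A : 'M[R]_1 => A 0 0) hb]; rewrite !mxE eqxx mulr1n.
Qed.

Lemma dot_comb X Y (a b : R) : dot (a *: X + b *: Y) (a *: X + b *: Y) =
  a ^+ 2 * dot X X + 2 * a * b * dot X Y + b ^+ 2 * dot Y Y.
Proof.
rewrite /dot !mulr_sumr -!big_split /=; apply: eq_bigr => i _.
by rewrite !mxE; ring.
Qed.

Variables (Om : set 'rV[R]_n) (z : 'rV[R]_n -> R).
Hypothesis oOm : open Om.
Hypothesis zC2 : C2_on Om z.

Lemma neg_schouten_form_sym x X Y : Om x -> neg_schouten_form z x X Y = neg_schouten_form z x Y X.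
Proof.
move=> Ox; rewrite /neg_schouten_form.
under eq_bigr do rewrite mulr_sumr.
rewrite exchange_big /=; apply: eq_bigr => i _; rewrite mulr_sumr.
apply: eq_bigr => j _; rewrite (neg_schouten_sym oOm zC2 j i Ox).
by move: (X 0 j) (Y 0 i) (neg_schouten z x i j) => *; ring.
Qed.

Lemma neg_schouten_form_combl x X Y Z (a b : R) : neg_schouten_form z x (a *: X + b *: Y) Z =
  a * neg_schouten_form z x X Z + b * neg_schouten_form z x Y Z.
Proof.
rewrite /neg_schouten_form !mulr_sumr -big_split /=; apply: eq_bigr => i _.
by rewrite !mxE mulrDl -!mulrA.
Qed.

Lemma neg_schouten_form_comb x X Y (a b : R) : Om x ->
  neg_schouten_form z x (a *: X + b *: Y) (a *: X + b *: Y) =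
  a ^+ 2 * neg_schouten_form z x X X + 2 * a * b * neg_schouten_form z x X Y
  + b ^+ 2 * neg_schouten_form z x Y Y.
Proof.
move=> Ox; rewrite neg_schouten_form_combl ![neg_schouten_form z x _ (_ + _)]neg_schouten_form_sym //.
rewrite !neg_schouten_form_combl (neg_schouten_form_sym Y X Ox).
by move: (neg_schouten_form z x X X) (neg_schouten_form z x X Y) (neg_schouten_form z x Y Y) => *; ring.
Qed.

(** With [W] the component of [Y] orthogonal to [X], multiplied by [|X|^2], one has
[|X|^2 Q = B(W, W) + G B(X, X)], where [Q] is the numerator of the sectional
curvature up to a negative factor and [G] the Gram determinant, which is positive
since [|W|^2 = |X|^2 G]. *)
Lemma sectional_conformal_lt0 (g : 'rV[R]_n -> 'M[R]_n) x X Y :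
  (forall x, Om x -> g x = expR (- 2 * z x) *: 1%:M) -> Om x ->
  (forall e, e != 0 -> 0 < neg_schouten_form z x e e) ->
  row_free (col_mx X Y) -> sectional g x X Y < 0.
Proof.
move=> gE Ox B0 rf.
have X0 : X != 0.
  apply/eqP => X0; have [/eqP] : (1 : R) = 0 /\ (0 : R) = 0.
    by apply: (row_free_col_mx_comb rf); rewrite X0 scaler0 scale0r addr0.
  by rewrite oner_eq0.
have dX := dot_gt0 X0.
pose W := - dot X Y *: X + dot X X *: Y.
have W0 : W != 0.
  by apply/eqP => /(row_free_col_mx_comb rf)[_ d0]; rewrite d0 ltxx in dX.
have dW := dot_gt0 W0.
have bW := B0 W W0.
rewrite dot_comb in dW; rewrite neg_schouten_form_comb // in bW.
have bX := B0 X X0.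
rewrite /sectional (sectional_numerator oOm zC2 gE) // !(gdot_conformal gE) //.
have E0 := expR_gt0 (- 2 * z x).
move: (dot X X) (dot X Y) (dot Y Y) (neg_schouten_form z x X X) (neg_schouten_form z x X Y)
  (neg_schouten_form z x Y Y) (expR (- 2 * z x)) dX dW bX bW E0 {W W0 B0 gE}
  => xx xy yy sx sxy sy E dX dW bX bW E0.
have G0 : 0 < xx * yy - xy ^+ 2.
  by rewrite -(pmulr_rgt0 _ dX); lra.
have Q0 : 0 < xx * sy + yy * sx - 2 * xy * sxy.
  have h : 0 < (xx * yy - xy ^+ 2) * sx by exact: mulr_gt0.
  by rewrite -(pmulr_rgt0 _ dX); lra.
have -> : E * xx * (E * yy) - (E * xy) ^+ 2 = E ^+ 2 * (xx * yy - xy ^+ 2) by ring.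
rewrite pmulr_llt0; last by rewrite invr_gt0 mulr_gt0 // exprn_gt0.
by rewrite mulNr oppr_lt0 mulr_gt0.
Qed.

End Planes.

Theorem theorem1p1 (R : realType) (n : nat) (hn : (3 <= n)%N)
    (Omega : set 'rV[R]_n) (u : 'rV[R]_n -> R)
    (hdom : domain Omega) (hbnd : bounded_set Omega) (hconv : convex_set Omega)
    (hu : loewner_nirenberg Omega u) :
  (forall x X Y : 'rV[R]_n, Omega x -> row_free (col_mx X Y) ->
     sectional (conformal_metric u) x X Y < 0)
  /\
  (forall x X : 'rV[R]_n, Omega x -> gdot (conformal_metric u) x X X = 1 ->
     ricci (conformal_metric u) x X X < - (n%:R / 2%:R)).
Proof.
have [oOm _] := hdom.
have cOm := convex_set_segments hconv.
pose z := log_solution u.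
have zC2 : C2_on Omega z by exact: log_solution_C2.
have zpde : forall x, Omega x ->
    laplacian z x = (n%:R / 2 - 1) * sqgrad z x - n%:R / 2 * expR (z x) ^- 2.
  by move=> x; exact: (log_solution_pde hn oOm hu).
have cV : continuous (exp_on Omega z) by exact: exp_log_solution_continuous.
have c1 : (1 : R) <= n%:R / 2.
  by rewrite ler_pdivlMr // mul1r ler_nat ltnW.
have n0 : (0 < n)%N by exact: leq_trans hn.
have gE x : Omega x -> conformal_metric u x = expR (- 2 * z x) *: 1%:M.
  by move=> Ox; rewrite /conformal_metric (conformal_factor hn hu Ox).
have B0 x e : Omega x -> e != 0 -> 0 < neg_schouten_form z x e e.
  move=> Ox e0; rewrite neg_schouten_formE.
  have h1 := exp_on_hess_le0 oOm hbnd cOm zC2 zpde c1 cV e Ox.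
  have h2 := log_strictly_concave oOm hbnd cOm zC2 zpde c1 cV n0 Ox e0.
  have d0 := dot_gt0 e0.
  have S0 : 0 <= sqgrad z x by apply: sumr_ge0 => i _; exact: sqr_ge0.
  have [S00|Sne] := eqVneq (sqgrad z x) 0.
    have g0 : grad_dir z x e = 0.
      apply: big1 => i _.
      move/psumr_eq0P : S00 => /(_ (fun i _ => sqr_ge0 _) i isT) /eqP.
      by rewrite sqrf_eq0 => /eqP ->; rewrite mulr0.
    by rewrite g0 S00 expr0n /=; lra.
  have Spos : 0 < sqgrad z x by rewrite lt_neqAle eq_sym Sne.
  have : 0 < sqgrad z x / 2 * dot e e by rewrite mulr_gt0 // divr_gt0.
  by lra.
split=> [x X Y Ox rf|x X Ox gX].
- by apply: (sectional_conformal_lt0 oOm zC2 gE Ox _ rf) => e; exact: B0.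
- have X0 : X != 0.
    apply: contraTneq (oner_neq0 R) => X0; rewrite negbK -gX (gdot_conformal gE) // X0.
    by rewrite /dot big1 ?mulr0 // => i _; rewrite mxE mul0r.
  rewrite (ricci_conformal oOm zC2 gE) // trace_neg_schouten zpde //.
  have B := B0 x X Ox X0.
  have n2 : (0 : R) < n%:R - 2 by rewrite subr_gt0 ltr_nat.
  have : 0 < (n%:R - 2) * neg_schouten_form z x X X by exact: mulr_gt0.
  have : dot X X * (n%:R / 2 * expR (z x) ^- 2) = n%:R / 2.
    have -> : expR (z x) ^- 2 = expR (- 2 * z x).
      by rewrite -expRM_natl -expRN; congr expR; rewrite mulNr.
    rewrite (gdot_conformal gE) // in gX.
    by rewrite mulrCA [dot X X * _]mulrC gX mulr1.
  rewrite opprB addrAC.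
  move: (dot X X) (neg_schouten_form z x X X) (expR (z x) ^- 2) (sqgrad z x) B => d s E S B h1 h2.
  have -> : n%:R / 2 * E - (n%:R / 2 - 1) * S + n%:R / 2 * S - S = n%:R / 2 * E by ring.
  by rewrite h1; lra.
Qed.
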